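(* There are absolute constants $0<c_1\le c_2$ such that the following holds. Let $n=2^d$, let $G$ be the $d$-cube and let $s\in V(G)$ be arbitrary. Then, with probability at least $1-o_n(1)$, $$c_1 d\le h(\mathcal{T}(G,s))\le c_2 d .$$
   Context: The $d$-cube is the graph with vertex set $\{0,1\}^d$ in which two vertices are adjacent if and only if they differ in exactly one coordinate. The notation $o_n(1)$ denotes a function of $n$ tending to $0$ as $n\to\infty$. For a connected graph $G$ on $n$ vertices and $s\in V(G)$, build random subtrees $T_1,\dots,T_n$ of $G$: $T_1$ is the single vertex $s$, and for $1<i\le n$, $T_i$ is obtained from $T_{i-1}$ by choosing, uniformly at random, an edge of $G$ with exactly one endpoint in $T_{i-1}$ and adding it (with its other endpoint) to $T_{i-1}$. The random spanning tree $T_n$, rooted at $s$, is denoted $\mathcal{T}(G,s)$. The height $h(T)$ of a rooted tree $T$ is the maximum number of edges on a root-to-leaf path. *)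

(* Defs.v *)
From HB Require Import structures.
From mathcomp Require Import all_boot all_order all_algebra.
From mathcomp Require Import reals.

Set Implicit Arguments.
Unset Strict Implicit.
Unset Printing Implicit Defensive.

Import Order.TTheory GRing.Theory Num.Theory.

Local Open Scope ring_scope.

Record sgraph := SGraph {
  vertex :> finType;
  adj : rel vertex;
  adj_sym : symmetric adj;
  adj_irr : irreflexive adj }.

(* Edges are unordered pairs of vertices. *)
Definition edges (G : sgraph) : {set {set G}} :=
  [set [set p.1; p.2] | p : G * G & adj p.1 p.2].

Definition cube_vertex (d : nat) := {ffun 'I_d -> bool}.

Definition cube_adj (d : nat) : rel (cube_vertex d) :=
  fun x y => #|[set i | x i != y i]| == 1%N.

Lemma cube_adj_sym d : symmetric (@cube_adj d).
Proof.
move=> x y; rewrite /cube_adj; congr (#|pred_of_set _| == _).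
by apply/setP => i; rewrite !inE eq_sym.
Qed.

Lemma cube_adj_irr d : irreflexive (@cube_adj d).
Proof.
move=> x; rewrite /cube_adj (_ : [set i | _] = set0) ?cards0 //.
by apply/setP => i; rewrite !inE eqxx.
Qed.

Definition cube (d : nat) : sgraph :=
  SGraph (@cube_adj_sym d) (@cube_adj_irr d).

(* A subgraph is the pair of its vertex set and its edge set. *)
Definition subgraph (G : sgraph) : finType := ({set G} * {set {set G}})%type.

Section RandomTree.
Variables (R : realType) (G : sgraph) (s : G).
Implicit Types (T : subgraph G) (f : {set G}).

Definition boundary T : {set {set G}} :=
  [set f in edges G | #|f :&: T.1| == 1%N].

Definition add_edge T f : subgraph G := (T.1 :|: f, f |: T.2).

(* [growth_law i T] is the probability that the tree T_(i+1) is [T]: the law of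
   T_1 is the point mass at the single vertex [s], and T_(i+2) arises from
   T_(i+1) by adding a uniformly random boundary edge. When the boundary is
   empty no mass is passed on; in a connected graph this never happens for
   i + 1 < #|G|. *)
Fixpoint growth_law (i : nat) (T : subgraph G) : R :=
  if i is j.+1 then
    \sum_(T0 : subgraph G) growth_law j T0 *
      \sum_(f in boundary T0 | add_edge T0 f == T) #|boundary T0|%:R^-1
  else (T == ([set s], set0))%:R.

(* The law of the spanning tree T_n, with n = #|G|. *)
Definition spanning_tree_law : subgraph G -> R := growth_law #|G|.-1.

Definition spanning_tree_prob (E : pred (subgraph G)) : R :=
  \sum_(T | E T) spanning_tree_law T.

Definition tree_adj T : rel G := fun x y => [set x; y] \in T.2.

(* A leaf is a vertex without children: a non-root vertex of degree 1, or the
   root if it has degree 0. *)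
Definition leaf T : pred G :=
  fun v => #|[set w | tree_adj T v w]| == (v != s) :> nat.

(* The root-to-leaf paths of [T] with [k] edges are the sequences [s :: p] with
   [p] of size [k]; they have no repeated vertex, so k < #|G|. *)
Definition height T : nat :=
  \max_(k < #|G|)
    \max_(p : k.-tuple G |
          [&& path (tree_adj T) s p, uniq (s :: p) & leaf T (last s p)]) k.

End RandomTree.

(* Main.v *)
Require Import Defs.
From HB Require Import structures.
From mathcomp Require Import all_boot all_order all_algebra.
From mathcomp Require Import reals ring lra zify.

Set Implicit Arguments.
Unset Strict Implicit.
Unset Printing Implicit Defensive.

Import Order.TTheory GRing.Theory Num.Theory.

Local Open Scope ring_scope.

(** The growth process is the jump chain of a lazy chain that draws uniformly
    random edges of the cube, one per tick, and adds the drawn edge whenever it is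
    a boundary edge. After [N] ticks the lazy tree is a function of a uniform word
    of length [N] over the edges, so everything reduces to counting such words;
    [visits_le_growth_law] and [spanning_tree_prob_ge] carry bounds on the lazy
    tree over to the growth process. With [M] edges in all, a bounded multiple of
    [M] ticks plays the part of a bounded time in first-passage percolation with
    independent exponential passage times of rate one.

    The lower bound on the height holds always, with constant 1. A spanning tree
    contains the antipode of the root, the tree path from the root to it has at
    least [d] edges, and every vertex of a grown tree lies on a root-to-leaf path
    ([root_leaf_path]).

    The upper bound has two ingredients. A path of the tree that leaves the root
    has received its edges in the order in which it traverses them
    ([tree_path_subseq]), so the expected number of root paths with [k] edges
    after [t * M] ticks is at most [(t * d) ^ k / k!]. This is exponentially small
    for [k] a large enough multiple of [t * d] ([prob_long_path]). It remains to
    see that some constant [t] suffices to cover the whole cube with high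
    probability ([prob_not_covered]).

    For the covering, let [s] and [v] differ exactly on a set [D] of coordinates,
    where [D] and its complement both have at least [d / 4] elements. For each [i]
    outside [D], consider the paths which flip [i], then flip the coordinates of
    [D] in any order inside the subcube so entered, and flip [i] back. Asking the
    [j]-th step inside the subcube to be drawn during the [j]-th of [#|D|] windows
    of ticks makes the count of such paths accessible to the second moment method:
    two random orders of [D] rarely share edges, and the second moment is at most
    twice the squared mean ([prob_crossing]). So each [i] succeeds with probability
    at least 1/8. Different [i] use disjoint sets of edges, and occurrences of
    letters of disjoint sets in a random word are negatively associated
    ([expect_prod_le]); hence all [i] fail with probability at most
    [(7 / 8) ^ (d / 4)] ([unreached_round]). A constant number of independent
    rounds lowers this to [4 ^- d]. An arbitrary pair of vertices is joined
    through a vertex in the middle ([cube_midpoint]), and a union bound over the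
    [2 ^ d] vertices finishes the proof. *)

(** * Uniform random words *)

Section Words.
Variables (R : realFieldType) (A : finType) (D : {set A}).
Hypothesis D_gt0 : (0 < #|D|)%N.
Implicit Types (f g : seq A -> R) (E : pred (seq A)).

Fixpoint expect (N : nat) f : R :=
  if N is n.+1 then
    (\sum_(x in D) expect n (fun e => f (x :: e))) / #|D|%:R
  else f [::].

Definition prob N E := expect N (fun e => (E e)%:R).

Lemma cardD_gt0 : 0 < #|D|%:R :> R.
Proof. by rewrite ltr0n. Qed.

Lemma cardD_neq0 : #|D|%:R != 0 :> R.
Proof. by rewrite lt0r_neq0 ?cardD_gt0. Qed.

Lemma le_expect_in N f g :
  (forall e, size e = N -> all (mem D) e -> f e <= g e) ->
  expect N f <= expect N g.
Proof.
elim: N f g => [|N IH] f g le_fg /=; first exact: le_fg.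
rewrite ler_pM2r ?invr_gt0 ?cardD_gt0 //; apply: ler_sum => x xD.
apply: IH => e se eD; apply: le_fg; rewrite /= ?se //.
by apply/andP; split.
Qed.

Lemma le_expect N f g : (forall e, f e <= g e) -> expect N f <= expect N g.
Proof. by move=> le_fg; apply: le_expect_in => e _ _; exact: le_fg. Qed.

Lemma eq_expect_in N f g :
  (forall e, size e = N -> all (mem D) e -> f e = g e) ->
  expect N f = expect N g.
Proof.
by move=> eq_fg; apply/eqP; rewrite eq_le; apply/andP; split;
  apply: le_expect_in => e se eD; rewrite eq_fg.
Qed.

Lemma eq_expect N f g : f =1 g -> expect N f = expect N g.
Proof. by move=> eq_fg; apply: eq_expect_in => e _ _; exact: eq_fg. Qed.

Lemma expect_cst N (c : R) : expect N (fun=> c) = c.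
Proof.
elim: N => //= N IH; rewrite (eq_bigr (fun=> c)) // big_const iter_addr_0.
by rewrite -[c *+ _]mulr_natr mulfK ?cardD_neq0.
Qed.

Lemma expectD N f g :
  expect N (fun e => f e + g e) = expect N f + expect N g.
Proof.
elim: N f g => //= N IH f g; rewrite -mulrDl -big_split /=; congr (_ / _).
by apply: eq_bigr => x _; rewrite IH.
Qed.

Lemma expectZ N (c : R) f : expect N (fun e => c * f e) = c * expect N f.
Proof.
elim: N f => //= N IH f; rewrite mulrA mulr_sumr; congr (_ / _).
by apply: eq_bigr => x _; rewrite IH.
Qed.

Lemma expect_sum (I : finType) (P : pred I) N (F : I -> seq A -> R) :
  expect N (fun e => \sum_(i | P i) F i e) = \sum_(i | P i) expect N (F i).
Proof.
elim: N F => //= N IH F.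
under eq_bigr do rewrite IH.
by rewrite exchange_big /= mulr_suml.
Qed.

Lemma expect_ge0 N f : (forall e, 0 <= f e) -> 0 <= expect N f.
Proof. by move=> f0; rewrite -(expect_cst N 0); apply: le_expect. Qed.

Lemma expect_cat N1 N2 f :
  expect (N1 + N2) f =
  expect N1 (fun e1 => expect N2 (fun e2 => f (e1 ++ e2))).
Proof. by elim: N1 f => //= N1 IH f; under eq_bigr do rewrite IH. Qed.

Lemma expect_rcons N f :
  expect N.+1 f =
  expect N (fun e => (\sum_(x in D) f (rcons e x)) / #|D|%:R).
Proof.
rewrite -addn1 expect_cat; apply: eq_expect => e /=; congr (_ / _).
by apply: eq_bigr => x _; rewrite cats1.
Qed.

Lemma expect_mul_cat N1 N2 f g :
  expect (N1 + N2) (fun e => f (take N1 e) * g (drop N1 e)) =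
  expect N1 f * expect N2 g.
Proof.
rewrite expect_cat mulrC -expectZ; apply: eq_expect_in => e1 se1 _.
rewrite mulrC -expectZ; apply: eq_expect => e2.
by rewrite take_cat drop_cat se1 ltnn subnn take0 drop0 cats0.
Qed.

Lemma prob_ge0 N E : 0 <= prob N E.
Proof. by apply: expect_ge0 => e; rewrite ler0n. Qed.

Lemma le_prob_in N E1 E2 :
  (forall e, size e = N -> all (mem D) e -> E1 e -> E2 e) ->
  prob N E1 <= prob N E2.
Proof.
move=> E12; apply: le_expect_in => e se eD; rewrite ler_nat.
by case: (E1 e) (E12 e se eD) => // ->.
Qed.

Lemma prob_le1 N E : prob N E <= 1.
Proof.
rewrite -[leRHS](expect_cst N 1); apply: le_expect => e.
by case: (E e); rewrite ?ler01.
Qed.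

Lemma probC N E : prob N (fun e => ~~ E e) = 1 - prob N E.
Proof.
rewrite -[X in X - _](expect_cst N 1) -mulN1r /prob -expectZ -expectD.
by apply: eq_expect => e; case: (E e) => /=; ring.
Qed.

Lemma prob_union (I : finType) (P : pred I) N (F : I -> pred (seq A)) :
  prob N (fun e => [exists (i | P i), F i e]) <= \sum_(i | P i) prob N (F i).
Proof.
rewrite /prob -expect_sum; apply: le_expect => e; case: existsP => [[i]|_] /=.
  move=> /andP[Pi Fi]; rewrite (bigD1 i) //= Fi lerDl.
  by apply: sumr_ge0 => j _; rewrite ler0n.
by apply: sumr_ge0 => j _; rewrite ler0n.
Qed.

Lemma probU N E1 E2 :
  prob N (fun e => E1 e || E2 e) <= prob N E1 + prob N E2.
Proof.
rewrite /prob -expectD; apply: le_expect => e.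
by case: (E1 e) (E2 e) => [] []; rewrite /= ?addr0 ?add0r // lerDl.
Qed.

(** ** Negative association *)

(** The relation allows the letters of [e1] and [e2] to differ arbitrarily at a
    position where [e2] has a letter outside [B]. A function monotone for it thus
    looks at nothing but the occurrences of the letters of [B], and decreases when
    such an occurrence is added. *)
Definition fewer_in (B : {set A}) (e1 e2 : seq A) :=
  all2 (fun x y => (y \in B) ==> (x == y)) e1 e2.

Definition decreasing_in (B : {set A}) f :=
  forall e1 e2, fewer_in B e1 e2 -> f e1 <= f e2.

Lemma fewer_in_refl B e : fewer_in B e e.
Proof. by rewrite /fewer_in; elim: e => //= x e ->; rewrite eqxx implybT. Qed.

Lemma fewer_in_take B n e1 e2 :
  fewer_in B e1 e2 -> fewer_in B (take n e1) (take n e2).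
Proof.
rewrite /fewer_in; elim: n e1 e2 => [|n IH] [|x e1] [|y e2] //= /andP[-> h].
exact: IH.
Qed.

Lemma fewer_in_drop B n e1 e2 :
  fewer_in B e1 e2 -> fewer_in B (drop n e1) (drop n e2).
Proof.
rewrite /fewer_in; elim: n e1 e2 => [|n IH] [|x e1] [|y e2] //= /andP[_ h].
exact: IH.
Qed.

Lemma fewer_in_mem B x e1 e2 :
  fewer_in B e1 e2 -> x \in B -> x \in e2 -> x \in e1.
Proof.
rewrite /fewer_in => h xB; elim: e1 e2 h => [|y e1 IH] [|z e2] //= /andP[/implyP yz h].
rewrite !inE => /orP[/eqP xz|xe2]; last by rewrite (IH e2) // orbT.
by move: yz; rewrite -xz xB => /(_ isT) /eqP->; rewrite eqxx.
Qed.

Lemma decreasing_notin x (B : {set A}) :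
  x \in B -> decreasing_in B (fun e => (x \notin e)%:R).
Proof.
move=> xB e1 e2 h; rewrite ler_nat; have := fewer_in_mem h xB.
by case: (x \in e2) => [->//|_]; exact: leq_b1.
Qed.

Lemma decreasing_cons B f x :
  decreasing_in B f -> decreasing_in B (fun e => f (x :: e)).
Proof.
by move=> fB e1 e2 h; apply: fB; rewrite /fewer_in /= eqxx implybT.
Qed.

Lemma decreasing_letter B f x y e : decreasing_in B f -> y \notin B ->
  f (x :: e) <= f (y :: e).
Proof.
move=> fB yB; apply: fB; rewrite /fewer_in /= (negPf yB) /=.
exact: fewer_in_refl.
Qed.

(** A letter cannot lie in both of two disjoint sets, so at a single position
    the two functions never drop below their largest values together; this is a
    negative correlation, and it passes to words position by position. For one
    position it is Chebyshev's sum inequality: averaging over pairs of letters,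
    every product of differences is nonpositive. *)
Lemma expect_mul_le N f g (B C : {set A}) : [disjoint B & C] ->
  decreasing_in B f -> decreasing_in C g ->
  expect N (fun e => f e * g e) <= expect N f * expect N g.
Proof.
move=> dBC; elim: N f g => [|N IH] f g fB gC //=.
set F := fun x => expect N (fun e => f (x :: e)).
set G := fun x => expect N (fun e => g (x :: e)).
have h1 : \sum_(x in D) expect N (fun e => f (x :: e) * g (x :: e)) <=
          \sum_(x in D) F x * G x.
  by apply: ler_sum => x _; apply: IH; exact: decreasing_cons.
have FB x y : y \notin B -> F x <= F y.
  by move=> yB; apply: le_expect => e; exact: (decreasing_letter x e fB yB).
have GC x y : y \notin C -> G x <= G y.
  by move=> yC; apply: le_expect => e; exact: (decreasing_letter x e gC yC).
have neg : \sum_(x in D) \sum_(y in D) (F x - F y) * (G x - G y) <= 0.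
  apply: sumr_le0 => x _; apply: sumr_le0 => y _.
  have [xB|xB] := boolP (x \in B); have [yB|yB] := boolP (y \in B).
  - have xC : x \notin C by rewrite (disjointFr dBC xB).
    have yC : y \notin C by rewrite (disjointFr dBC yB).
    by rewrite (_ : G x = G y) ?subrr ?mulr0 //; apply/le_anti/andP; split; apply: GC.
  - have xC : x \notin C by rewrite (disjointFr dBC xB).
    by apply: mulr_le0_ge0; rewrite ?subr_le0 ?subr_ge0 ?FB ?GC.
  - have yC : y \notin C by rewrite (disjointFr dBC yB).
    by apply: mulr_ge0_le0; rewrite ?subr_le0 ?subr_ge0 ?FB ?GC.
  - by rewrite (_ : F x = F y) ?subrr ?mul0r //; apply/le_anti/andP; split; apply: FB.
have expand : \sum_(x in D) \sum_(y in D) (F x - F y) * (G x - G y) =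
    2%:R * (#|D|%:R * (\sum_(x in D) F x * G x) -
           (\sum_(x in D) F x) * (\sum_(x in D) G x)).
  have -> : \sum_(x in D) \sum_(y in D) (F x - F y) * (G x - G y) =
      \sum_(x in D) (#|D|%:R * (F x * G x) - F x * (\sum_(y in D) G y)
        - G x * (\sum_(y in D) F y) + \sum_(y in D) F y * G y).
    apply: eq_bigr => x _.
    rewrite -[#|D|%:R]/(#|D|%:R) -sum1_card natr_sum mulr_suml !mulr_sumr.
    rewrite -!sumrB -big_split /=; apply: eq_bigr => y _; ring.
  rewrite big_split /= !sumrB -!mulr_sumr -!mulr_suml.
  rewrite big_const iter_addr_0 -[_ *+ _]mulr_natl.
  ring.
rewrite expand pmulr_rle0 // subr_le0 in neg.
rewrite mulrACA -invfM ler_pdivlMr; last by rewrite mulr_gt0 ?cardD_gt0.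
rewrite mulrA divfK ?cardD_neq0 //.
apply: le_trans neg; rewrite mulrC ler_pM2l ?cardD_gt0 //.
Qed.

Lemma decreasing_prod (I : eqType) (r : seq I) (F : I -> seq A -> R)
    (Bs : I -> {set A}) (B : {set A}) :
  (forall i e, 0 <= F i e) ->
  (forall i, i \in r -> decreasing_in (Bs i) (F i)) ->
  (forall i, i \in r -> Bs i \subset B) ->
  decreasing_in B (fun e => \prod_(i <- r) F i e).
Proof.
move=> F0 FB sB e1 e2 h; rewrite !big_seq; apply: ler_prod => i ir.
rewrite F0 /=; apply: (FB i ir).
move: h; rewrite /fewer_in !all2E => /andP[-> /=].
apply: sub_all => -[x y] /= /implyP yB; apply/implyP => yi.
by apply: yB; apply: subsetP yi; exact: sB.
Qed.

Lemma expect_prod_le (I : finType) (r : seq I) N (F : I -> seq A -> R)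
    (Bs : I -> {set A}) : uniq r ->
  (forall i e, 0 <= F i e) ->
  (forall i, i \in r -> decreasing_in (Bs i) (F i)) ->
  (forall i j, i \in r -> j \in r -> i != j -> [disjoint Bs i & Bs j]) ->
  expect N (fun e => \prod_(i <- r) F i e) <= \prod_(i <- r) expect N (F i).
Proof.
move=> + F0; elim: r => [|i r IH] /= => [_ _ _|/andP[ir ur] FB dB].
  rewrite big_nil (@eq_expect _ _ (fun=> 1)) ?expect_cst // => e.
  by rewrite big_nil.
rewrite big_cons (@eq_expect _ _ (fun e => F i e * \prod_(j <- r) F j e)); last first.
  by move=> e; rewrite big_cons.
apply: le_trans (_ : expect N (F i) * expect N (fun e => \prod_(j <- r) F j e) <= _).
  apply: (@expect_mul_le _ _ _ (Bs i) (\bigcup_(j | j \in r) Bs j)).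
  - rewrite disjoints_subset; apply/subsetP => x xi; rewrite inE.
    apply/bigcupP => -[j jr xj].
    have ij : i != j by apply: contraNneq ir => ->.
    by rewrite (disjointFr (dB i j _ _ ij) xi) ?mem_head ?in_cons ?jr ?orbT in xj.
  - by apply: FB; rewrite mem_head.
  apply: decreasing_prod => // j jr; last exact: bigcup_sup.
  by apply: FB; rewrite in_cons jr orbT.
apply: ler_wpM2l; first exact: expect_ge0.
apply: IH => // [j jr|j k jr kr]; first by apply: FB; rewrite in_cons jr orbT.
by apply: dB; rewrite in_cons ?jr ?kr orbT.
Qed.

(** ** Occurrence of prescribed letters *)

(** The probability that a given letter occurs among [N] uniform ones. *)
Definition hit N : R := 1 - (1 - #|D|%:R^-1) ^+ N.

Lemma miss_prob N x : x \in D ->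
  prob N (fun e => x \notin e) = (1 - #|D|%:R^-1) ^+ N.
Proof.
move=> xD; rewrite /prob; elim: N => [|N IH] //=.
rewrite (bigD1 x) //= (@eq_expect _ _ (fun=> 0)); last first.
  by move=> e; rewrite in_cons eqxx.
rewrite expect_cst add0r (eq_bigr (fun=> (1 - #|D|%:R^-1) ^+ N)); last first.
  move=> y /andP[_ yx]; rewrite -IH; apply: eq_expect => e.
  by rewrite in_cons negb_or eq_sym yx.
rewrite big_const iter_addr_0 exprSr -[_ *+ _]mulr_natr -mulrA; congr (_ * _).
rewrite (_ : #|_| = #|D|.-1)%N; last first.
  rewrite (cardsD1 x) xD /= -cardsE; apply: eq_card => y.
  by rewrite !inE andbC.
by rewrite -subn1 natrB // mulrBl divff ?cardD_neq0 // mul1r.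
Qed.

Lemma hit_prob N x : x \in D -> prob N (fun e => x \in e) = hit N.
Proof.
move=> xD; rewrite /hit -(miss_prob N xD) probC opprB addrCA subrr addr0.
by [].
Qed.

Lemma hit_ge0 N : 0 <= hit N.
Proof.
case/card_gt0P: D_gt0 => x xD; rewrite -(hit_prob N xD); exact: prob_ge0.
Qed.

(** Two letters compete for the positions, so their occurrences are negatively
    correlated; the complements are covered by [expect_mul_le]. *)
Lemma hit2_prob N x y : x \in D -> y \in D -> x != y ->
  expect N (fun e => (x \in e)%:R * (y \in e)%:R) <= hit N ^+ 2.
Proof.
move=> xD yD xy.
have nn : expect N (fun e => (x \notin e)%:R * (y \notin e)%:R) <=
    (1 - #|D|%:R^-1) ^+ N * (1 - #|D|%:R^-1) ^+ N.
  rewrite -{1}(miss_prob N xD) -(miss_prob N yD).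
  apply: (@expect_mul_le _ _ _ [set x] [set y]).
  - by rewrite disjoints1 inE.
  - by apply: decreasing_notin; rewrite inE.
  - by apply: decreasing_notin; rewrite inE.
rewrite (@eq_expect _ _ (fun e => 1 + (-1) * (x \notin e)%:R +
   (-1) * (y \notin e)%:R + (x \notin e)%:R * (y \notin e)%:R)); last first.
  by move=> e; case: (x \in e); case: (y \in e) => /=; ring.
rewrite !expectD !expectZ expect_cst.
have := miss_prob N xD; have := miss_prob N yD; rewrite /prob => -> ->.
by rewrite /hit; lra.
Qed.

(** Bernoulli's inequality makes [hit N] at least of the order of the expected
    number of occurrences as long as the latter is at most one. *)
Lemma hit_ge N : N%:R / (#|D|%:R + N%:R) <= hit N.
Proof.
set M : R := #|D|%:R; have M0 : 0 < M := cardD_gt0.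
have M1 : M^-1 <= 1 by rewrite invf_le1 // ler1n.
have bern : 1 + N%:R / M <= (1 + M^-1) ^+ N.
  elim: N => [|N IH]; first by rewrite mul0r addr0.
  rewrite exprS; apply: le_trans (_ : (1 + M^-1) * (1 + N%:R / M) <= _); last first.
    by apply: ler_wpM2l => //; rewrite addr_ge0 // invr_ge0 ltW.
  rewrite -natr1; have : 0 <= M^-1 * (N%:R / M) :> R.
    by rewrite !mulr_ge0 ?invr_ge0 ?ler0n ?ltW.
  by lra.
have pos : 0 < 1 + N%:R / M.
  by apply: ltr_wpDr => //; rewrite divr_ge0 ?ler0n ?ltW.
have prod1 : (1 - M^-1) ^+ N * (1 + N%:R / M) <= 1.
  apply: le_trans (_ : (1 - M^-1) ^+ N * (1 + M^-1) ^+ N <= _).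
    by apply: ler_wpM2l => //; rewrite exprn_ge0 // subr_ge0.
  rewrite -exprMn; apply: exprn_ile1.
    by apply: mulr_ge0; rewrite ?subr_ge0 // addr_ge0 // invr_ge0 ltW.
  have : 0 <= M^-1 * M^-1 by rewrite mulr_ge0 // invr_ge0 ltW.
  lra.
have -> : N%:R / (M + N%:R) = 1 - (1 + N%:R / M)^-1.
  have : M + N%:R != 0 by rewrite lt0r_neq0 // ltr_wpDr.
  by move=> h; field; rewrite h lt0r_neq0.
by rewrite /hit lerD2l lerN2 -[leRHS]mul1r ler_pdivlMr.
Qed.

End Words.

(** * Factorial estimates *)

(** One factorial absorbs the other: each new factor [b + 2] on the left is at most
    the new factor [a + b + 2] on the right. *)
Lemma fact_mul_le a b : (a.+1`! * b.+1`! <= (a + b).+1`!)%N.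
Proof.
elim: b => [|b IH]; first by rewrite addn0 muln1.
rewrite addnS [b.+2`!]factS mulnCA [X in (_ <= X)%N]factS.
by apply: leq_mul => //; rewrite !ltnS leq_addl.
Qed.

(** Of the [n + 1] terms the two extreme ones equal [n!], and each of the others
    is at most [(n - 1)!]. *)
Lemma sum_fact_mul_le n : (\sum_(i < n.+1) (n - i)`! * i`! <= 3 * n`!)%N.
Proof.
case: n => [|n]; first by rewrite big_ord1.
rewrite big_ord_recl big_ord_recr /= subn0 fact0 muln1 /bump leq0n add1n subnn mul1n.
have : (\sum_(i < n) (n.+1 - (bump 0 i))`! * (bump 0 i)`! <= n * n`!)%N.
  rewrite -[X in (_ <= X * _)%N](card_ord n) -sum_nat_const.
  apply: leq_sum => i _; rewrite /bump leq0n add1n subSS -subnSK //.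
  by apply: leq_trans (fact_mul_le _ _) _; rewrite -addnS subnK.
move: (\sum_(i < n) _)%N => S; rewrite factS; lia.
Qed.

(** Bernoulli's inequality for [1 - 1 / (D + 1)], cleared of denominators, keeps
    [(1 + 1 / D) ^ k] below 2 up to [k = (D + 1) / 2]; two such factors give the
    bound 4 below. *)
Lemma succ_exp_le2 D k : (k.*2 <= D.+1 -> D.+1 ^ k <= 2 * D ^ k)%N.
Proof.
have bern : ((D.+1 - k) * D.+1 ^ k <= D.+1 * D ^ k)%N.
  elim: k => [|k IH]; first by rewrite subn0.
  have [kD|Dk] := leqP D.+1 k.+1; first by rewrite (eqP kD) mul0n.
  apply: leq_trans (_ : D * ((D.+1 - k) * D.+1 ^ k) <= _)%N.
    rewrite expnS !mulnA leq_mul2r; apply/orP; right; nia.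
  by rewrite expnS [(D.+1 * _)%N]mulnCA leq_mul2l IH orbT.
move=> k2; rewrite -(@leq_pmul2l D.+1) // mulnCA.
apply: leq_trans (_ : 2 * ((D.+1 - k) * D.+1 ^ k) <= _)%N.
  by rewrite mulnA leq_mul2r; apply/orP; right; lia.
by rewrite leq_mul2l bern.
Qed.

Lemma succ_exp_le4 D k : (k <= D -> D.+1 ^ k <= 4 * D ^ k)%N.
Proof.
move=> kD; rewrite -(odd_double_half k) -addnn addnA !expnD.
rewrite -[4%N]/(2 * 2)%N mulnACA; apply: leq_mul; last first.
  by apply: succ_exp_le2; lia.
by rewrite -!expnD; apply: succ_exp_le2; lia.
Qed.

(** A form of [k! >= (k / 4) ^ k] that also serves initial segments of the
    factorial. *)
Lemma exp_le_ffact k D : (k <= D)%N -> (D ^ k <= 4 ^ k * D ^_ k)%N.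
Proof.
elim: D k => [|D IH] [|k] //; rewrite ltnS => kD.
rewrite ffactSS !expnS.
apply: leq_trans (_ : D.+1 * (4 * D ^ k) <= _)%N.
  by rewrite leq_mul2l succ_exp_le4.
by have := IH _ kD; nia.
Qed.

Section SecondMomentRecursion.
Variables (R : realFieldType) (q : R).
Hypothesis q_ge0 : 0 <= q.

(** The weight [m! * pair_weight m] will bound the second moment of the number of
    crossings of an [m]-dimensional cube, in units of [p ^ (2 * m)] for
    [q = 1 / p]. The exact second moment satisfies a renewal inequality in which
    all smaller weights occur; this one-step recursion dominates it by
    [pair_weight_conv] and is easy to solve. *)
Fixpoint pair_weight (m : nat) : R :=
  if m is n.+1 then m`!%:R + 3 * q * pair_weight n else 1.

Lemma pair_weight_ge0 m : 0 <= pair_weight m.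
Proof.
by elim: m => //= m IH; rewrite addr_ge0 ?ler0n // !mulr_ge0.
Qed.

(** Peeling off one step of the recursion turns the convolution into itself plus a
    sum of products of two factorials; the constant 3 of the recursion is the one
    of [sum_fact_mul_le]. *)
Lemma pair_weight_conv n :
  \sum_(i < n.+1) (n - i)`!%:R * pair_weight i <= 3 * pair_weight n.
Proof.
elim: n => [|n IH]; first by rewrite big_ord1 /= mul1r; lra.
rewrite big_ord_recl /= subn0 mulr1.
have -> : \sum_(i < n.+1) (n.+1 - bump 0 i)`!%:R *
     ((bump 0 i)`!%:R + 3 * q * pair_weight i) =
   (\sum_(i < n.+1) (n.+1 - i.+1)`! * (i.+1)`!)%:R +
   3 * q * \sum_(i < n.+1) (n - i)`!%:R * pair_weight i.
  rewrite natr_sum mulr_sumr -big_split /=; apply: eq_bigr => i _.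
  by rewrite /bump leq0n add1n subSS natrM; ring.
have := ler_wpM2l (_ : 0 <= 3 * q) IH.
rewrite mulr_ge0 // => /(_ isT).
have := sum_fact_mul_le n.+1; rewrite big_ord_recl /= subn0 muln1 => h.
have : ((n.+1)`! + (\sum_(i < n.+1) (n.+1 - i.+1)`! * (i.+1)`!))%:R <=
   (3 * n.+1`!)%:R :> R by rewrite ler_nat.
rewrite natrD natrM; lra.
Qed.

Lemma pair_weightE m :
  pair_weight m <= \sum_(k < m.+1) (3 * q) ^+ k * (m - k)`!%:R.
Proof.
elim: m => [|m IH] /=; first by rewrite big_ord1 mul1r.
rewrite big_ord_recl /= subn0 mul1r lerD2l.
have := ler_wpM2l (_ : 0 <= 3 * q) IH; rewrite mulr_ge0 // => /(_ isT) h.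
apply: le_trans h _; rewrite mulr_sumr; apply: ler_sum => i _.
by rewrite /bump leq0n add1n subSS exprS mulrA.
Qed.

End SecondMomentRecursion.

Lemma sum_half_exp (R : realFieldType) n : \sum_(k < n) (2^-1 : R) ^+ k <= 2.
Proof.
suff -> : \sum_(k < n) (2^-1 : R) ^+ k = 2 - 2 * 2^-1 ^+ n.
  by rewrite gerBl mulr_ge0 // exprn_ge0 // invr_ge0.
elim: n => [|n IH]; first by rewrite big_ord0 expr0; lra.
by rewrite big_ord_recr /= IH exprS; lra.
Qed.

(** For [q] a small multiple of [D] the terms of the explicit sum decay
    geometrically, so the first one dominates. *)
Lemma pair_weight_le (R : realFieldType) (q : R) (D : nat) :
  0 <= q -> 24 * q <= D%:R -> pair_weight q D <= 2 * D`!%:R.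
Proof.
move=> q0 qD; apply: le_trans (pair_weightE q0 D) _.
apply: le_trans (_ : \sum_(k < D.+1) 2^-1 ^+ k * D`!%:R <= _); last first.
  by rewrite -mulr_suml ler_wpM2r ?ler0n ?sum_half_exp.
apply: ler_sum => k _; have kD : (k <= D)%N by rewrite -ltnS.
apply: le_trans (_ : (D%:R / 8) ^+ k * (D - k)`!%:R <= _).
  rewrite ler_wpM2r ?ler0n // lerXn2r ?nnegrE ?mulr_ge0 ?ler0n ?invr_ge0 //.
  by lra.
rewrite exprMn mulrAC -natrX -natrM.
have h : (D ^ k * (D - k)`! <= 4 ^ k * D`!)%N.
  by rewrite -(ffact_fact kD) mulnA leq_mul2r exp_le_ffact // orbT.
apply: le_trans (_ : (4 ^ k * D`!)%:R * 8^-1 ^+ k <= _).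
  by rewrite ler_wpM2r ?ler_nat // exprn_ge0 // invr_ge0.
rewrite natrM natrX mulrAC -exprMn.
by rewrite (_ : 4%:R * 8^-1 = 2^-1 :> R) //; lra.
Qed.

(** * Second moment for monotone crossings *)

Section Crossing.
Variables (R : realFieldType) (A : finType) (D : {set A}).
Hypothesis D_gt0 : (0 < #|D|)%N.
Variables (I : finType) (ed : {set I} -> I -> A) (W : nat).
(** The letter [ed B b] stands for the step from the set [B :\ b] to [B]. *)
Hypothesis edD : forall (B : {set I}) b, b \in B -> ed B b \in D.
Hypothesis ed_inj : forall (B C : {set I}) b c, b \in B -> c \in C -> #|B| = #|C| ->
  ed B b = ed C c -> B = C /\ b = c.

(** The number of orders in which the elements of [B] can be added one by one, the
    step number [j] being drawn in the window number [j] of [W] letters. It is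
    meant for [#|B| = n]. *)
Fixpoint crossings (n : nat) (e : seq A) (B : {set I}) : R :=
  if n is m.+1 then
    \sum_(b in B) crossings m (take (m * W) e) (B :\ b) *
                  (ed B b \in drop (m * W) e)%:R
  else 1.

Local Notation p := (hit R D W).
Local Notation Ex := (@expect R A D).

Lemma crossings_ge0 n e B : 0 <= crossings n e B.
Proof.
elim: n e B => //= n IH e B; apply: sumr_ge0 => b _.
by rewrite mulr_ge0 ?ler0n.
Qed.

Lemma expect_crossings n (B : {set I}) : #|B| = n ->
  Ex (n * W) (fun e => crossings n e B) = n`!%:R * p ^+ n.
Proof.
elim: n B => [|n IH] B cB; first by rewrite /= mul1r.
rewrite mulSnr /= expect_sum.
rewrite (eq_bigr (fun=> n`!%:R * p ^+ n * p)); last first.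
  move=> b bB; rewrite (@expect_mul_cat R A D D_gt0 _ _
    (fun e => crossings n e (B :\ b)) (fun e => (ed B b \in e)%:R)).
  rewrite IH; last by move: cB; rewrite (cardsD1 b) bB => -[].
  by have := hit_prob R D_gt0 W (edD bB); rewrite /prob => ->.
by rewrite big_const iter_addr_0 cB -[_ *+ n.+1]mulr_natl factS natrM exprSr; ring.
Qed.

Let q := p^-1.
Let c j : R := j`!%:R * pair_weight q j.
Let w (J : {set I}) : R := q * #|J|%:R * c #|J|.-1.

Let q_ge0 : 0 <= q. Proof. by rewrite invr_ge0 hit_ge0. Qed.
Let w_ge0 J : 0 <= w J.
Proof. by rewrite !mulr_ge0 ?ler0n ?pair_weight_ge0. Qed.

Hypothesis p_gt0 : 0 < p.

(** The sum runs over the highest set [J] at which two crossings, ending in [B] and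
    in [C], have a common last step: above [J] they are free, whence the squared
    factorial, and the common step and all that lies below it cost [w J]. *)
Let pair_bound n (B C : {set I}) : R :=
  n`!%:R ^+ 2 + \sum_(J : {set I} | [&& J != set0, J \subset B & J \subset C])
                   (n - #|J|)`!%:R ^+ 2 * w J.

(** Grouping the sets [J] by their size turns the sum into the convolution of
    [pair_weight_conv]. *)
Let pair_bound_diag n (B : {set I}) : #|B| = n -> pair_bound n B B <= c n.
Proof.
move=> cB; rewrite /pair_bound.
rewrite (partition_big (fun J : {set I} => inord #|J| : 'I_n.+1) predT) //=.
have -> : \sum_(j < n.+1) \sum_(J : {set I} | [&& J != set0, J \subset B & J \subset B] &&
     (inord #|J| == j)) (n - #|J|)`!%:R ^+ 2 * w J =
   \sum_(j < n.+1) (j != ord0)%:R * (n`!%:R * (n - j)`!%:R * q * pair_weight q j.-1).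
  apply: eq_bigr => j _.
  have [->|j0] := eqVneq j ord0.
    rewrite mul0r big1 // => J /andP[/and3P[J0 JB _] /eqP].
    move/(congr1 (@nat_of_ord _)); rewrite inordK ?ltnS -?cB ?subset_leq_card //=.
    by move/eqP; rewrite cards_eq0 (negPf J0).
  rewrite mul1r.
  rewrite (eq_bigl (fun J : {set I} => 
      J \in [set J0 : {set I} | J0 \subset B & #|J0| == j])).
    rewrite (eq_bigr (fun=> (n - j)`!%:R ^+ 2 * (q * j%:R * c j.-1))); last first.
      by move=> J; rewrite inE => /andP[_ /eqP jj]; rewrite /w jj.
    rewrite big_const iter_addr_0 cards_draws cB -[_ *+ _]mulr_natl.
    have jn : (j <= n)%N by rewrite -ltnS.
    rewrite -(bin_fact jn) /c !natrM.
    have : (0 < j)%N by rewrite lt0n; move: j0; rewrite -(inj_eq val_inj).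
    case: (nat_of_ord j) => // k _ /=.
    by rewrite factS natrM; ring.
  move=> J; rewrite inE; case JB: (J \subset B); rewrite ?andbF //=.
  have Jn : (#|J| < n.+1)%N by rewrite ltnS -cB subset_leq_card.
  rewrite -(inj_eq (@ord_inj _)) inordK // andbT.
  by rewrite -cards_eq0; case: (#|J| =P j) => [->|_]; rewrite ?andbF ?andbT.
rewrite big_ord_recl /= mul0r add0r.
have := pair_weight_conv q_ge0; case: n cB => [|n] cB; last move=> /(_ n).
  by rewrite big_ord0 /c /= fact0 expr1n; lra.
move=> h; rewrite /c /= mulrDr expr2 lerD2l.
under eq_bigr do rewrite /bump leq0n add1n subSS mul1r -!mulrA.
rewrite -mulr_sumr ler_wpM2l ?ler0n //.
have -> : \sum_(i < n.+1) (n - i)`!%:R * (q * pair_weight q i) =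
   q * \sum_(i < n.+1) (n - i)`!%:R * pair_weight q i.
  by rewrite mulr_sumr; apply: eq_bigr => i _; ring.
by rewrite -mulrA mulrCA ler_wpM2l.
Qed.

(** For a fixed [J] below both [B] and [C] there are [n + 1 - #|J|] elements that
    each set may lose while still containing [J], which completes the factorials;
    the case [J = B = C] is the extra term on the left. *)
Let pair_bound_step n (B C : {set I}) : #|B| = n.+1 -> #|C| = n.+1 ->
  \sum_(b in B) \sum_(c in C) pair_bound n (B :\ b) (C :\ c) +
    (B == C)%:R * w B <= pair_bound n.+1 B C.
Proof.
move=> cB cC; rewrite /pair_bound.
pose t (J : {set I}) := (n - #|J|)`!%:R ^+ 2 * w J.
have notinE (E J : {set I}) : J \subset E -> #|E| = n.+1 ->
    \sum_(x in E) (x \notin J)%:R = (n.+1 - #|J|)%:R :> R.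
  move=> JE cE; rewrite -natr_sum; congr _%:R.
  rewrite -cE -cardsDS // -sum1_card [in RHS]big_mkcond [in LHS]big_mkcond /=.
  by apply: eq_bigr => x _; rewrite !inE andbC; case: (x \in E); case: (x \in J).
have -> : \sum_(b in B) \sum_(c in C) (n`!%:R ^+ 2 + \sum_(J : {set I} |
      [&& J != set0, J \subset B :\ b & J \subset C :\ c]) t J) =
   n.+1`!%:R ^+ 2 + \sum_(J : {set I} | [&& J != set0, J \subset B & J \subset C])
      (n.+1 - #|J|)%:R ^+ 2 * t J.
  under eq_bigr do rewrite big_split /= big_const iter_addr_0 cC.
  rewrite big_split /= big_const iter_addr_0 cB; congr (_ + _).
    by rewrite -!mulrnA -mulr_natl factS !natrM; ring.
  rewrite (eq_bigr (fun b => \sum_(J : {set I} |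
      [&& J != set0, J \subset B & J \subset C])
         (b \notin J)%:R * ((n.+1 - #|J|)%:R * t J))); last first.
    move=> b bB; rewrite (eq_bigr (fun c => \sum_(J : {set I} |
      [&& J != set0, J \subset B & J \subset C])
         (c \notin J)%:R * ((b \notin J)%:R * t J))); last first.
      move=> x xC; rewrite big_mkcond [RHS]big_mkcond /=.
      apply: eq_bigr => J _; rewrite !subsetD1.
      case: (J != set0); case: (J \subset B); case: (J \subset C);
      case: (b \notin J); case: (x \notin J); rewrite /= ?mul0r ?mul1r //.
    rewrite exchange_big /=; apply: eq_bigr => J /and3P[_ _ JC].
    by rewrite -mulr_suml notinE //; ring.
  rewrite exchange_big /=; apply: eq_bigr => J /and3P[_ JB _].
  by rewrite -mulr_suml notinE //; ring.
rewrite -addrA lerD2l.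
have -> : (B == C)%:R * w B = \sum_(J : {set I} |
    [&& J != set0, J \subset B & J \subset C]) ((B == C) && (J == B))%:R * w J.
  have [<-|BC] := eqVneq B C; last first.
    by rewrite mul0r big1 // => J _; rewrite mul0r.
  rewrite (bigD1 B) /= ?subxx ?andbT; last by rewrite -cards_eq0 cB.
  by rewrite eqxx big1 ?addr0 // => J /andP[_ /negPf ->]; rewrite mul0r.
rewrite -big_split /=; apply: ler_sum => J /and3P[J0 JB JC].
rewrite /t mulrA -mulrDl ler_wpM2r //.
have : (#|J| <= n.+1)%N by rewrite -cB subset_leq_card.
rewrite leq_eqVlt => /orP[/eqP cJ|Jn].
  rewrite cJ subnn expr0n mul0r add0r fact0 expr1n.
  by case: (_ && _); rewrite ?ler01.
have -> : (J == B) = false.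
  by apply/eqP => JB'; rewrite JB' cB ltnn in Jn.
by rewrite andbF addr0 subSn // factS natrM exprMn.
Qed.

(** The two crossings are revealed window by window from the top. Until they
    first use a common edge the pair costs at most the square of the mean;
    a common edge costs [p] instead of [p ^ 2] and leaves both crossings at the
    same set, where the bound for a single set applies again. *)
Lemma expect_crossings_pair n (B C : {set I}) : #|B| = n -> #|C| = n ->
  Ex (n * W) (fun e => crossings n e B * crossings n e C) <=
    p ^+ n.*2 * pair_bound n B C.
Proof.
elim: n B C => [|n IH] B C cB cC.
  rewrite /= double0 expr0 !mul1r /pair_bound fact0 expr1n lerDl; apply: sumr_ge0 => J _.
  by rewrite mulr_ge0 // exprn_ge0 // ler0n.
have subB (E : {set I}) x : #|E| = n.+1 -> x \in E -> #|E :\ x| = n.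
  by move=> cE xE; move: cE; rewrite (cardsD1 x) xE => -[].
pose X b x := Ex (n * W) (fun e => crossings n e (B :\ b) * crossings n e (C :\ x)).
have X0 b x : 0 <= X b x.
  by apply: (expect_ge0 D_gt0) => e; rewrite mulr_ge0 ?crossings_ge0.
rewrite mulSnr.
have -> : Ex (n * W + W) (fun e => crossings n.+1 e B * crossings n.+1 e C) =
   \sum_(b in B) \sum_(c in C) X b c *
     Ex W (fun e => (ed B b \in e)%:R * (ed C c \in e)%:R).
  rewrite (@eq_expect _ _ _ D_gt0 _ _ (fun e => \sum_(b in B) \sum_(c in C)
      (crossings n (take (n * W) e) (B :\ b) * crossings n (take (n * W) e) (C :\ c))
      * ((ed B b \in drop (n * W) e)%:R * (ed C c \in drop (n * W) e)%:R))); last first.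
    move=> e /=; rewrite mulr_suml; apply: eq_bigr => b _.
    by rewrite mulr_sumr; apply: eq_bigr => x _; ring.
  rewrite expect_sum; apply: eq_bigr => b _.
  rewrite expect_sum; apply: eq_bigr => x _.
  exact: (expect_mul_cat D_gt0 _ _
    (fun e => crossings n e (B :\ b) * crossings n e (C :\ x))
    (fun e => (ed B b \in e)%:R * (ed C x \in e)%:R)).
apply: le_trans (_ : \sum_(b in B) \sum_(c in C)
    X b c * (p ^+ 2 + ((B == C) && (b == c))%:R * p) <= _).
  apply: ler_sum => b bB; apply: ler_sum => x xC; apply: ler_wpM2l => //.
  have [/eqP e|ne] := boolP (ed B b == ed C x).
    have [-> ->] := ed_inj bB xC (etrans cB (esym cC)) e.
    rewrite !eqxx mul1r (@eq_expect _ _ _ D_gt0 _ _ (fun e => (ed C x \in e)%:R)).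
      have := hit_prob R D_gt0 W (edD xC); rewrite /prob => ->.
      by rewrite lerDr sqr_ge0.
    by move=> e'; case: (_ \in e'); rewrite /= ?mulr0 ?mulr1.
  apply: le_trans (hit2_prob R D_gt0 W (edD bB) (edD xC) ne) _.
  by rewrite lerDl mulr_ge0 ?ler0n ?hit_ge0.
apply: le_trans (_ : p ^+ n.+1.*2 * (\sum_(b in B) \sum_(c in C)
    pair_bound n (B :\ b) (C :\ c) + (B == C)%:R * w B) <= _); last first.
  by rewrite ler_wpM2l ?exprn_ge0 ?hit_ge0 // pair_bound_step.
have -> : \sum_(b in B) \sum_(c in C)
    X b c * (p ^+ 2 + ((B == C) && (b == c))%:R * p) =
  \sum_(b in B) \sum_(c in C) X b c * p ^+ 2 +
  \sum_(b in B) \sum_(c in C) ((B == C) && (b == c))%:R * (X b c * p).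
  rewrite -big_split /=; apply: eq_bigr => b _.
  by rewrite -big_split /=; apply: eq_bigr => x _; ring.
have p2S : p ^+ n.+1.*2 = p ^+ n.*2 * p ^+ 2 by rewrite -exprD addn2.
rewrite mulrDr; apply: lerD.
  rewrite mulr_sumr; apply: ler_sum => b bB.
  rewrite mulr_sumr; apply: ler_sum => x xC.
  rewrite p2S [leRHS]mulrAC ler_wpM2r ?exprn_ge0 ?hit_ge0 //.
  by apply: IH; apply: subB.
have [BC|BC] := eqVneq B C; last first.
  rewrite mul0r mulr0 big1 // => b _; rewrite big1 // => x _.
  by rewrite mul0r.
rewrite mul1r /w cB /= -BC.
apply: le_trans (_ : \sum_(b in B) p ^+ n.*2 * c n * p <= _).
  apply: ler_sum => b bB; rewrite (bigD1 b) //= eqxx mul1r big1 ?addr0; last first.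
    by move=> x /andP[_ xb]; rewrite eq_sym (negPf xb) mul0r.
  rewrite ler_wpM2r ?hit_ge0 //.
  rewrite /X -BC; apply: le_trans (IH _ _ (subB _ _ cB bB) (subB _ _ cB bB)) _.
  by rewrite ler_wpM2l ?exprn_ge0 ?hit_ge0 // pair_bound_diag // subB.
rewrite big_const iter_addr_0 cB -[_ *+ _]mulr_natl p2S expr2.
rewrite /q le_eqVlt; apply/orP; left; apply/eqP; field.
by rewrite lt0r_neq0.
Qed.

(** Cauchy-Schwarz: with second moment at most twice the squared mean, a crossing
    exists with probability at least one half. *)
Lemma prob_crossing (B : {set I}) : 24 <= #|B|%:R * p ->
  2^-1 <= prob R D (#|B| * W) (fun e => crossings #|B| e B != 0).
Proof.
move=> Bp; set n := #|B|.
have q24 : 24 * q <= n%:R by rewrite ler_pdivrMr.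
set m := Ex (n * W) (fun e => crossings n e B).
have m_gt0 : 0 < m.
  by rewrite /m expect_crossings // mulr_gt0 ?exprn_gt0 // ltr0n fact_gt0.
have m2 : Ex (n * W) (fun e => crossings n e B * crossings n e B) <= 2 * m ^+ 2.
  apply: le_trans (expect_crossings_pair (erefl n) (erefl n)) _.
  apply: le_trans (ler_wpM2l _ (pair_bound_diag (erefl n))) _.
    by rewrite exprn_ge0 ?hit_ge0.
  rewrite /c /m expect_crossings // exprMn -exprM muln2.
  rewrite [leRHS](_ : _ = p ^+ n.*2 * (n`!%:R * (2 * n`!%:R))); last by ring.
  by rewrite !ler_wpM2l ?exprn_ge0 ?hit_ge0 ?ler0n // pair_weight_le.
(* The indicator of a nonzero [z] is at least [2 z / c - z ^ 2 / c ^ 2] for every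
   [c]; the choice [c = 2 m] is optimal for the bound [m2]. *)
apply: le_trans (_ : Ex (n * W) (fun e => m^-1 * crossings n e B +
   (- (4 * m ^+ 2)^-1) * (crossings n e B * crossings n e B)) <= _).
  rewrite expectD // !expectZ // -/m.
  have : (4 * m ^+ 2)^-1 * Ex (n * W) (fun e => crossings n e B * crossings n e B)
     <= (4 * m ^+ 2)^-1 * (2 * m ^+ 2).
    by rewrite ler_wpM2l // invr_ge0 mulr_ge0 // sqr_ge0.
  rewrite mulVf ?lt0r_neq0 //.
  have -> : (4 * m ^+ 2)^-1 * (2 * m ^+ 2) = 2^-1.
    by field; rewrite lt0r_neq0.
  by rewrite mulNr; lra.
apply: (le_expect D_gt0) => e; have [->|_] := eqVneq (crossings n e B) 0.
  by rewrite !mulr0 addr0.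
set z := crossings n e B.
have : 0 <= (1 - (2 * m)^-1 * z) ^+ 2 by rewrite sqr_ge0.
have -> : (1 - (2 * m)^-1 * z) ^+ 2 = 1 - (m^-1 * z - (4 * m ^+ 2)^-1 * (z * z)).
  by field; rewrite lt0r_neq0.
by rewrite mulNr -[(~~ false)%:R]/(1 : R); lra.
Qed.

End Crossing.

(** * Long monotone paths *)

Section LongPaths.
Variables (R : realFieldType) (G : sgraph) (deg : nat).
Hypothesis edges_gt0 : (0 < #|edges G|)%N.
Hypothesis deg_le : forall x : G, (#|[set y | adj x y]| <= deg)%N.

Definition path_edges (x : G) (p : seq G) : seq {set G} :=
  pairmap (fun a b => [set a; b]) x p.

Definition has_path (k : nat) (x : G) (e : seq {set G}) : bool :=
  [exists p : k.-tuple G, path (@adj G) x p && subseq (path_edges x p) e].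

Lemma has_path_cons k x f e :
  (has_path k.+1 x (f :: e))%:R <= (has_path k.+1 x e)%:R +
    \sum_(y | adj x y) (f == [set x; y])%:R * (has_path k y e)%:R :> R.
Proof.
have sum0 : 0 <= \sum_(y | adj x y) (f == [set x; y])%:R * (has_path k y e)%:R :> R.
  by apply: sumr_ge0 => y _; rewrite mulr_ge0.
have [h|hn] := boolP (has_path k.+1 x e).
  by apply: le_trans (_ : 1 <= _); [case: (has_path _ _ _) | rewrite lerDl].
rewrite add0r; have [/existsP[p /andP[pp]]|//] := boolP (has_path k.+1 x (f :: e)).
case/tupleP: p pp => y p; rewrite /path_edges /= => /andP[xy yp].
case: eqP => [fxy|_] sp; last first.
  by case/existsP: hn; exists [tuple of y :: p]; rewrite /path_edges /= xy yp.
rewrite (bigD1 y) //= -fxy eqxx mul1r.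
have -> : has_path k y e by apply/existsP; exists p; rewrite yp.
by rewrite lerDl; apply: sumr_ge0 => z _; rewrite mulr_ge0.
Qed.

(** The first letter either is of no use, or is one of the at most [deg] possible
    first steps of the path; the induction on the word is Pascal's rule. *)
Lemma prob_has_path N k x :
  prob R (edges G) N (has_path k x) <=
    'C(N, k)%:R * (deg%:R / #|edges G|%:R) ^+ k.
Proof.
elim: N k x => [|N IH] [|k] x.
- by rewrite bin0 expr0 mulr1 prob_le1.
- rewrite bin0n mul0r /prob /=.
  have [/existsP[p /andP[_]]|//] := boolP (has_path k.+1 x [::]).
  by case/tupleP: p.
- by rewrite bin0 expr0 mulr1 prob_le1.
set M : R := #|edges G|%:R; have M0 : 0 < M by rewrite ltr0n.
set B := fun N k => 'C(N, k)%:R * (deg%:R / M) ^+ k.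
rewrite /prob /= ler_pdivrMr //.
apply: le_trans (_ : \sum_(f in edges G) (prob R (edges G) N (has_path k.+1 x) +
   \sum_(y | adj x y) (f == [set x; y])%:R * prob R (edges G) N (has_path k y)) <= _).
  apply: ler_sum => f _.
  apply: le_trans (le_expect edges_gt0 N (has_path_cons k x f)) _.
  rewrite expectD // lerD2l expect_sum; apply: ler_sum => y _.
  by rewrite expectZ.
rewrite big_split /= big_const iter_addr_0 -[_ *+ _]mulr_natr -/M exchange_big /=.
apply: le_trans (_ : B N k.+1 * M + deg%:R * B N k <= _).
  apply: lerD; first by rewrite ler_wpM2r ?IH ?ltW.
  apply: le_trans (_ : \sum_(y | adj x y) B N k <= _).
    apply: ler_sum => y _; rewrite -mulr_suml; apply: le_trans (IH k y).
    rewrite -[leRHS]mul1r ler_wpM2r ?prob_ge0 //.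
    have [xy|xy] := boolP ([set x; y] \in edges G).
      rewrite (bigD1 [set x; y]) //= eqxx big1 ?addr0 // => f /andP[_ /negPf ->].
      by [].
    rewrite big1 // => f fG; case: eqP => // fxy.
    by rewrite -fxy fG in xy.
  rewrite big_const iter_addr_0 -[_ *+ _]mulr_natl ler_wpM2r //.
    by rewrite /B mulr_ge0 // exprn_ge0 // divr_ge0 // ltW.
  by rewrite ler_nat; move: (deg_le x); rewrite cardsE.
rewrite /B binS natrD exprS le_eqVlt; apply/orP; left; apply/eqP.
by field; rewrite lt0r_neq0.
Qed.

End LongPaths.

(** * The lazy chain *)

Section LazyChain.
Variables (R : realType) (G : sgraph) (s : G).
Hypothesis edges_gt0 : (0 < #|edges G|)%N.
Implicit Types (T : subgraph G) (f : {set G}) (e : seq {set G}).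

Definition lazy_step T f := if f \in boundary T then add_edge T f else T.

Definition lazy_tree e : subgraph G := foldl lazy_step ([set s], set0) e.

Lemma lazy_tree_rcons e f : lazy_tree (rcons e f) = lazy_step (lazy_tree e) f.
Proof. exact: foldl_rcons. Qed.

Lemma boundaryP T f : f \in boundary T ->
  exists u w, [/\ f = [set u; w], adj u w, u \in T.1 & w \notin T.1].
Proof.
rewrite inE => /andP[/imsetP[[u w] /=]]; rewrite inE /= => uw -> /cards1P[x ex].
have uw' : u != w by apply: contraTneq uw => ->; rewrite adj_irr.
have [uT|uT] := boolP (u \in T.1); have [wT|wT] := boolP (w \in T.1).
- have /set1P ux : u \in [set x] by rewrite -ex !inE eqxx uT.
  have /set1P wx : w \in [set x] by rewrite -ex !inE eqxx wT orbT.
  by rewrite ux wx eqxx in uw'.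
- by exists u, w.
- by exists w, u; rewrite setUC adj_sym.
have : x \in [set x] by rewrite inE.
by rewrite -ex !inE => /andP[/orP[]/eqP->]; rewrite ?(negPf uT) ?(negPf wT).
Qed.

Lemma boundary_card T f : f \in boundary T -> #|(add_edge T f).1| = #|T.1|.+1.
Proof.
case/boundaryP => u [w [-> _ uT wT]] /=.
rewrite (_ : _ :|: _ = w |: T.1) ?cardsU1 ?wT //.
by apply/setP => x; rewrite !inE; have [->|_] := eqVneq x u; rewrite ?uT ?orbT //= orbC.
Qed.

Lemma card_lazy_tree_gt0 e : (0 < #|(lazy_tree e).1|)%N.
Proof.
elim/last_ind: e => [|e f IH]; first by rewrite cards1.
by rewrite lazy_tree_rcons /lazy_step; case: ifP => // /boundary_card ->.
Qed.

Local Notation M := (#|edges G|%:R : R).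
Local Notation visit N T := (prob R (edges G) N (fun e => lazy_tree e == T)).
Let inflow T0 T : R := \sum_(f in boundary T0 | add_edge T0 f == T) M^-1.

(** Balance of mass: what is at [T] leaves at each tick with probability
    [#|boundary T| / M], and mass arrives from the trees that [T] extends. *)
Lemma visit_step N T :
  visit N.+1 T + visit N T * (#|boundary T|%:R / M) =
  visit N T + \sum_(T0 : subgraph G) visit N T0 * inflow T0 T.
Proof.
have M0 : M != 0 by rewrite pnatr_eq0 -lt0n.
rewrite /prob (expect_rcons edges_gt0).
under [in RHS]eq_bigr do rewrite mulrC -expectZ.
rewrite -expect_sum -expectD // [X in _ + X]mulrC -expectZ -expectD //.
apply: (eq_expect edges_gt0) => e; set T1 := lazy_tree e.
rewrite [in RHS](bigD1 T1) //= eqxx mulr1.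
rewrite [X in _ + (_ + X)]big1 ?addr0; last first.
  by move=> T0 T01; rewrite [_ == T0]eq_sym (negPf T01) mulr0.
apply: (mulIf M0); rewrite !mulrDl mulfVK //.
have -> : inflow T1 T * M = (\sum_(f in boundary T1) (add_edge T1 f == T)%:R).
  rewrite /inflow mulr_suml big_mkcondr /=; apply: eq_bigr => f _.
  by case: ifP => // _; rewrite mulVf.
have -> : \sum_(f in edges G) (lazy_tree (rcons e f) == T)%:R =
   \sum_(f in boundary T1) (add_edge T1 f == T)%:R +
   (M - #|boundary T1|%:R) * (T1 == T)%:R :> R.
  rewrite (bigID (fun f => f \in boundary T1)) /=; congr (_ + _).
    rewrite (eq_bigl (fun f => f \in boundary T1)) => [|f]; last first.
      by rewrite /= inE; case: (f \in edges G).
    by apply: eq_bigr => f fb; rewrite lazy_tree_rcons /lazy_step fb.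
  rewrite (eq_bigr (fun=> (T1 == T)%:R)); last first.
    by move=> f /andP[_ /negPf fb]; rewrite lazy_tree_rcons /lazy_step fb.
  rewrite big_const iter_addr_0 -[_ *+ _]mulr_natl; congr (_ * _).
  have sb : boundary T1 \subset edges G by apply/subsetP => f; rewrite inE => /andP[].
  rewrite -natrB ?subset_leq_card //; congr _%:R; rewrite -cardsDS //.
  by apply: eq_card => f; rewrite [RHS]inE andbC.
have [->|_] := eqVneq T1 T; last by rewrite !mulr0 !mul0r !addr0 add0r.
by rewrite !mulr1 !mul1r mulfVK //; ring.
Qed.

(** A tree on [i + 1] vertices is left for ever once it is left, and a stay ends
    with the same law as the growth step; hence the expected number of visits,
    weighted by the probability of leaving, is bounded by the law of the growth
    process, and what has not yet left is counted on top. *)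
Lemma visits_le_growth_law i T N : #|T.1| = i.+1 ->
  visit N T + (\sum_(k < N) visit k T) * (#|boundary T|%:R / M) <=
  growth_law R s i T.
Proof.
have M0 : 0 < M by rewrite ltr0n.
have visit_ge0 k T' : 0 <= visit k T' by apply: prob_ge0.
have balance T' : visit N T' + (\sum_(k < N) visit k T') * (#|boundary T'|%:R / M) =
    (T' == ([set s], set0))%:R +
    \sum_(T0 : subgraph G) (\sum_(k < N) visit k T0) * inflow T0 T'.
  elim: N => [|n IH].
    rewrite big_ord0 mul0r addr0 big1 ?addr0; last by move=> *; rewrite big_ord0 mul0r.
    by rewrite /prob /= eq_sym.
  rewrite big_ord_recr /= mulrDl addrCA visit_step addrA [_ + visit n T']addrC IH.
  rewrite -addrA -big_split /=; congr (_ + _); apply: eq_bigr => T0 _.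
  by rewrite big_ord_recr mulrDl.
elim: i T => [|i IH] T cT; rewrite balance.
  rewrite /= big1 ?addr0 // => T0 _.
  have [->|] := eqVneq (inflow T0 T) 0; first by rewrite mulr0.
  move=> h; have T0e : T0.1 = set0.
    case: (pickP (fun f => (f \in boundary T0) && (add_edge T0 f == T))) => [f|no].
      move=> /andP[fb /eqP ft]; move: (boundary_card fb); rewrite ft cT => -[] /esym.
      by move/eqP; rewrite cards_eq0 => /eqP.
    by rewrite /inflow big_pred0 ?eqxx // in h.
  rewrite big1 ?mul0r // => k _; rewrite /prob -[RHS](expect_cst edges_gt0 k 0).
  apply: eq_expect => // e; case: eqP => // he.
  by have := card_lazy_tree_gt0 e; rewrite he T0e cards0.
have -> : (T == ([set s], set0)) = false.
  by apply/eqP => h; move: cT; rewrite h cards1.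
rewrite add0r /=; apply: ler_sum => T0 _; rewrite /inflow !mulr_sumr.
apply: ler_sum => f /andP[fb /eqP ft].
have cT0 : #|T0.1| = i.+1 by move: (boundary_card fb); rewrite ft cT => -[].
have b0 : 0 < #|boundary T0|%:R :> R by rewrite ltr0n; apply/card_gt0P; exists f.
rewrite ler_pdivlMr //; apply: le_trans (IH _ cT0).
by rewrite mulrAC -mulrA lerDr.
Qed.

Lemma growth_law_ge0 i T : 0 <= growth_law R s i T.
Proof.
elim: i T => [|i IH] T /=; first by rewrite ler0n.
apply: sumr_ge0 => T0 _; rewrite mulr_ge0 //; apply: sumr_ge0 => f _.
by rewrite invr_ge0.
Qed.

(** Nothing leaves a spanning tree, so there the bound of [visits_le_growth_law]
    compares the laws themselves. *)
Lemma spanning_tree_prob_ge N (P : pred (subgraph G)) :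
  prob R (edges G) N (fun e => ((lazy_tree e).1 == setT) && P (lazy_tree e)) <=
  spanning_tree_prob R s P.
Proof.
have G0 : (0 < #|G|)%N by apply/card_gt0P; exists s.
rewrite /spanning_tree_prob.
apply: le_trans (_ : \sum_(T | P T && (T.1 == setT)) visit N T <= _).
  rewrite /prob -expect_sum; apply: le_expect => // e.
  case: andP => [[eT Pe]|_]; last by apply: sumr_ge0 => T _; rewrite ler0n.
  rewrite (bigD1 (lazy_tree e)) ?Pe //= eqxx lerDl.
  by apply: sumr_ge0 => T _; rewrite ler0n.
rewrite [leRHS](bigID (fun T => T.1 == setT)) /=.
apply: ler_wpDr; first by apply: sumr_ge0 => T _; exact: growth_law_ge0.
apply: ler_sum => T /andP[_ /eqP cT].
have cT' : #|T.1| = #|G|.-1.+1 by rewrite cT cardsT prednK.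
apply: le_trans (visits_le_growth_law N cT'); rewrite lerDl.
rewrite mulr_ge0 // ?divr_ge0 // ?ler0n //.
by apply: sumr_ge0 => k _; apply: prob_ge0.
Qed.

End LazyChain.

(** * Paths in a grown tree *)

Section GrownTree.
Variables (G : sgraph) (s : G).
Implicit Types (T : subgraph G) (f : {set G}) (e : seq {set G}).

Local Notation lazy_tree := (lazy_tree s).

Lemma set2_eqP (x y u w : G) : [set x; y] = [set u; w] ->
  (x = u /\ y = w) \/ (x = w /\ y = u).
Proof.
move=> h.
have xi : x \in [set u; w] by rewrite -h !inE eqxx.
have yi : y \in [set u; w] by rewrite -h !inE eqxx orbT.
have ui : u \in [set x; y] by rewrite h !inE eqxx.
have wi : w \in [set x; y] by rewrite h !inE eqxx orbT.
move: xi yi ui wi; rewrite !inE.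
by do 4![case/orP => /eqP ?]; subst; auto.
Qed.

Definition well_formed T :=
  (s \in T.1) /\ (forall x y, tree_adj T x y -> [/\ x \in T.1, y \in T.1 & adj x y]).

Lemma tree_adj_add T u w x y :
  tree_adj (add_edge T [set u; w]) x y =
  ([set x; y] == [set u; w]) || tree_adj T x y.
Proof. by rewrite /tree_adj !inE. Qed.

Lemma well_formed_lazy e : well_formed (lazy_tree e).
Proof.
elim/last_ind: e => [|e f [sT wf]].
  by split=> [|x y]; rewrite ?inE // /tree_adj inE.
rewrite lazy_tree_rcons /lazy_step; case: ifP => // /boundaryP [u [w [-> uw uT wT]]].
split; first by rewrite !inE sT.
move=> x y; rewrite tree_adj_add => /orP[/eqP /set2_eqP[[-> ->]|[-> ->]]|/wf[xT yT xy]].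
- by rewrite !inE !eqxx uT uw !orbT.
- by rewrite !inE !eqxx uT adj_sym uw !orbT.
- by rewrite !inE xT yT.
Qed.

Section Step.
Variables (T : subgraph G) (u w : G).
Hypotheses (wfT : well_formed T) (uT : u \in T.1) (wT : w \notin T.1).
Local Notation T' := (add_edge T [set u; w]).

Lemma sub_tree_path x p : path (tree_adj T) x p -> path (tree_adj T') x p.
Proof. by apply: sub_path => a b; rewrite tree_adj_add => ->; rewrite orbT. Qed.

Lemma tree_path_in x p : x \in T.1 -> path (tree_adj T) x p -> all (mem T.1) p.
Proof.
elim: p x => //= y p IH x xT /andP[/(proj2 wfT)[_ yT _] yp].
by rewrite [_ \in _]yT (IH y).
Qed.

(** The new vertex has degree one, so a path without repetition can only end
    there. *)
Lemma tree_path_add x p : x \in T.1 -> path (tree_adj T') x p -> uniq (x :: p) ->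
  path (tree_adj T) x p \/
  exists p', [/\ p = rcons p' w, path (tree_adj T) x p' & last x p' = u].
Proof.
elim: p x => [|y p IH] x xT; first by left.
rewrite [path _ _ _]/= tree_adj_add => /andP[xy yp] /andP[xnot ue].
have xw : x != w by apply: contraNneq wT => <-.
case/orP: xy => [/eqP /set2_eqP[[xu yw]|[xw']]|xy]; first last.
- have [_ yT _] := proj2 wfT _ _ xy.
  case: (IH y yT yp ue) => [h|[p' [-> h1 h2]]]; first by left; rewrite /= xy.
  by right; exists (y :: p'); rewrite /= xy.
- by rewrite xw' eqxx in xw.
right; exists [::]; rewrite /= -xu; split=> //.
case: p {IH} yp xnot ue => [|z p] /=; first by rewrite yw.
rewrite yw tree_adj_add => /andP[/orP[/eqP /set2_eqP[[wu _]|[_ zu]]|wz] _] + _.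
- by move: wT; rewrite wu uT.
- by rewrite zu xu !inE eqxx orbT.
- by have [] := proj2 wfT _ _ wz; rewrite (negPf wT).
Qed.

Lemma leaf_add_old v : v \in T.1 -> v != u -> leaf s T' v = leaf s T v.
Proof.
move=> vT vu; rewrite /leaf; congr (_ == _); apply: eq_card => x.
rewrite !inE tree_adj_add; case: eqP => // /set2_eqP[[vu' _]|[vw _]].
  by rewrite vu' eqxx in vu.
by rewrite vw (negPf wT) in vT.
Qed.

Lemma leaf_add_new : leaf s T' w.
Proof.
have ws : w != s by apply: contraNneq wT => ->; case: wfT.
rewrite /leaf ws; apply/cards1P; exists u; apply/setP => x.
rewrite !inE tree_adj_add; apply/idP/eqP => [|->]; last by rewrite setUC eqxx.
case/orP => [/eqP /set2_eqP[[wu _]|[_ ->//]]|/(proj2 wfT)[]].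
  by move: wT; rewrite wu uT.
by rewrite (negPf wT).
Qed.

End Step.

Lemma path_edges_rcons (x : G) p y :
  path_edges x (rcons p y) = rcons (path_edges x p) [set last x p; y].
Proof. by rewrite /path_edges; elim: p x => //= z p IH x; rewrite IH. Qed.

(** Edges are added outwards from the root, hence in their order along any path
    leaving the root. *)
Lemma tree_path_subseq e p : path (tree_adj (lazy_tree e)) s p -> uniq (s :: p) ->
  subseq (path_edges s p) e.
Proof.
elim/last_ind: e p => [|e f IH] p.
  by case: p => //= y p; rewrite /tree_adj inE.
have up q : subseq q e -> subseq q (rcons e f).
  by move=> h; apply: subseq_trans h (subseq_rcons _ _).
rewrite lazy_tree_rcons /lazy_step; case: ifP => [|_ h1 h2]; last exact/up/IH.
have wf := well_formed_lazy e.
case/boundaryP => u [w [fe uw uT wT]] pp us; move: pp; rewrite fe => pp.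
case: (tree_path_add wf uT wT (proj1 wf) pp us) => [h|[p' [p'e h1 h2]]].
  by rewrite -fe; exact/up/IH.
rewrite p'e path_edges_rcons h2 -!cats1 cat_subseq // IH //.
by move: us; rewrite p'e -rcons_cons rcons_uniq => /andP[].
Qed.

(** When a leaf [u] gets the new vertex [w] as a child, a root-to-leaf path that
    ended in [u] is prolonged to [w]; all other root-to-leaf paths survive. *)
Lemma root_leaf_path e v : v \in (lazy_tree e).1 ->
  exists p, [/\ path (tree_adj (lazy_tree e)) s p, uniq (s :: p),
    leaf s (lazy_tree e) (last s p) & v \in s :: p].
Proof.
elim/last_ind: e v => [|e f IH] v.
  rewrite inE => /eqP ->; exists [::]; rewrite /= mem_head; split=> //.
  rewrite /leaf /= eqxx cards_eq0; apply/eqP/setP => x.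
  by rewrite !inE /tree_adj inE.
rewrite lazy_tree_rcons /lazy_step; case: ifP => [|_]; last exact: IH.
case/boundaryP => u [w [-> uw uT wT]].
have wf := well_formed_lazy e; have sT := proj1 wf.
have extend p : path (tree_adj (lazy_tree e)) s p -> uniq (s :: p) -> last s p = u ->
    [/\ path (tree_adj (add_edge (lazy_tree e) [set u; w])) s (rcons p w),
        uniq (s :: rcons p w) &
        leaf s (add_edge (lazy_tree e) [set u; w]) (last s (rcons p w))].
  move=> pp us lu; split.
  - by rewrite rcons_path (sub_tree_path _ _ pp) lu tree_adj_add eqxx.
  - rewrite -rcons_cons rcons_uniq us andbT; apply: contra wT.
    rewrite inE => /orP[/eqP ->//|].
    exact: (allP (tree_path_in wf sT pp)).
  - by rewrite last_rcons leaf_add_new.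
rewrite !inE => /orP[vT|vuw].
  have [p [pp us lp vp]] := IH v vT.
  have [lu|lu] := eqVneq (last s p) u.
    have [h1 h2 h3] := extend p pp us lu.
    by exists (rcons p w); split=> //; rewrite -rcons_cons mem_rcons inE vp orbT.
  exists p; split=> //; first exact: sub_tree_path.
  rewrite leaf_add_old //.
  have : last s p \in s :: p by rewrite mem_last.
  by rewrite inE => /orP[/eqP->//|]; exact: (allP (tree_path_in wf sT pp)).
have [p [pp us lp vp]] := IH u uT.
have [p1 [p1p u1 l1]] : exists p1, [/\ path (tree_adj (lazy_tree e)) s p1,
    uniq (s :: p1) & last s p1 = u].
  case/splitPl: {pp us lp} vp pp us => p1 p2 lu.
  rewrite cat_path -cat_cons cat_uniq => /andP[pp _] /andP[us _].
  by exists p1.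
have [h1 h2 h3] := extend p1 p1p u1 l1.
exists (rcons p1 w); split=> //; rewrite -rcons_cons mem_rcons.
by case/orP: vuw => /eqP ->; rewrite inE ?eqxx // -l1 mem_last orbT.
Qed.

Lemma lazy_step_sub T f : T.1 \subset (lazy_step T f).1.
Proof. by rewrite /lazy_step; case: ifP => //= _; exact: subsetUl. Qed.

Lemma foldl_lazy_sub T e : T.1 \subset (foldl (@lazy_step G) T e).1.
Proof.
elim: e T => //= f e IH T; exact: subset_trans (lazy_step_sub T f) (IH _).
Qed.

(** An edge that is drawn while one of its endpoints is in the tree has both
    endpoints in the tree afterwards, whether or not it was a boundary edge. *)
Lemma foldl_lazy_reach T e x p : x \in T.1 -> path (@adj G) x p ->
  subseq (path_edges x p) e -> last x p \in (foldl (@lazy_step G) T e).1.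
Proof.
elim: e T x p => [|f e IH] T x [|y p] xT.
- by [].
- by [].
- by move=> _ _; apply: subsetP xT; exact: foldl_lazy_sub.
rewrite /path_edges /= => /andP[xy yp]; case: eqP => [fe|_] sp; last first.
  by apply: (IH _ x (y :: p)); rewrite /= ?xy //; apply: subsetP xT; exact: lazy_step_sub.
apply: IH => //; rewrite /lazy_step; case: ifP => [_|]; first by rewrite -fe !inE eqxx !orbT.
rewrite -fe inE => /negbT; rewrite negb_and => /orP[/negP[]|].
  by apply/imsetP; exists (x, y); rewrite ?inE.
apply: contraR => yT; apply/cards1P; exists x; apply/setP => z; rewrite !inE.
have [->|] := eqVneq z x; first by rewrite xT.
by have [->|] := eqVneq z y; rewrite //= (negPf yT).
Qed.

Lemma lazy_tree_reach e p : path (@adj G) s p -> subseq (path_edges s p) e ->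
  last s p \in (lazy_tree e).1.
Proof. by apply: foldl_lazy_reach; rewrite inE. Qed.

Lemma height_ge e k v : v \in (lazy_tree e).1 ->
  (forall p, path (@adj G) s p -> last s p = v -> (k <= size p)%N) ->
  (k <= height s (lazy_tree e))%N.
Proof.
move=> /root_leaf_path[p [pp us lp vp]] dist.
have ps : (size p < #|G|)%N.
  by have /card_uniqP h := us; rewrite -[(size p).+1]/(size (s :: p)) -h max_card.
have adjp q : path (tree_adj (lazy_tree e)) s q -> path (@adj G) s q.
  by apply: sub_path => a b /(proj2 (well_formed_lazy e))[].
apply: leq_trans (_ : size p <= _)%N.
  case/splitPl: vp pp => p1 p2 l1; rewrite cat_path => /andP[p1p _].
  by rewrite size_cat (leq_trans (dist _ (adjp _ p1p) l1)) // leq_addr.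
apply: leq_trans (leq_bigmax (Ordinal ps)) => /=.
rewrite -[X in (X <= _)%N]/(nat_of_ord (Ordinal ps)).
by apply: (@leq_bigmax_cond _ _ _ (in_tuple p)) => /=; rewrite pp lp -/(uniq (s :: p)) us.
Qed.

(** A long path of the tree may be cut after [k] edges: the count of paths needs
    no leaf at the end. *)
Lemma has_path_height e k : (k <= height s (lazy_tree e))%N -> has_path k s e.
Proof.
have [->|k0] := posnP k.
  move=> _; apply/existsP; exists [tuple] => /=; exact: sub0seq.
apply: contraTT => hn; rewrite -ltnNge -[k]prednK // ltnS.
apply/bigmax_leqP => j _; apply/bigmax_leqP => p /and3P[pp us _].
rewrite -ltnS prednK // ltnNge; apply: contra hn => kj.
have kp : size (take k p) == k by rewrite size_takel // size_tuple.
apply/existsP; exists (Tuple kp) => /=.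
have pk := take_path k pp.
rewrite (sub_path _ pk) /=; last by move=> a b /(proj2 (well_formed_lazy e))[].
by apply: tree_path_subseq; rewrite // -[s :: _]/(take k.+1 (s :: p)) take_uniq.
Qed.

End GrownTree.

(** * Reaching a vertex *)

Section Reach.
Variable G : sgraph.
Implicit Types (T : subgraph G) (e : seq {set G}) (x y z : G).

(** Reaching is defined by the tree grown from [x], not by time-increasing paths:
    so it is monotone in the initial tree, and it composes over concatenation. *)
Definition reach x y e := y \in (lazy_tree x e).1.

Lemma lazy_step_mono T1 T2 f : T1.1 \subset T2.1 ->
  (lazy_step T1 f).1 \subset (lazy_step T2 f).1.
Proof.
move=> s12; rewrite {1}/lazy_step; case: ifP => [f1|_]; last first.
  exact: subset_trans s12 (lazy_step_sub _ _).
rewrite /= subUset (subset_trans s12 (lazy_step_sub _ _)) /=.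
have fG : f \in edges G by move: f1; rewrite inE => /andP[].
case/boundaryP: f1 fG => u [w [-> uw uT wT]] fG.
have u2 := subsetP s12 _ uT.
rewrite /lazy_step; case: ifP => /= [_|]; first exact: subsetUr.
rewrite inE fG /= => h; rewrite subUset !sub1set u2 /=.
apply: contraFT h => w2; apply/cards1P; exists u; apply/setP => x; rewrite !inE.
have [->|] := eqVneq x u; first by rewrite u2.
by have [->|] := eqVneq x w; rewrite //= (negPf w2).
Qed.

Lemma foldl_lazy_mono T1 T2 e : T1.1 \subset T2.1 ->
  (foldl (@lazy_step G) T1 e).1 \subset (foldl (@lazy_step G) T2 e).1.
Proof.
by elim: e T1 T2 => //= f e IH T1 T2 s12; apply: IH; apply: lazy_step_mono.
Qed.

Lemma reach_refl x e : reach x x e.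
Proof. by apply: (subsetP (foldl_lazy_sub _ _)); rewrite inE. Qed.

Lemma reach_cat x y z e1 e2 : reach x y e1 -> reach y z e2 -> reach x z (e1 ++ e2).
Proof.
rewrite /reach {3}/lazy_tree foldl_cat => xy; apply: subsetP.
by apply: foldl_lazy_mono; rewrite /= sub1set.
Qed.

Lemma reach_edge x y e : adj x y -> [set x; y] \in e -> reach x y e.
Proof.
move=> xy xye; apply: (@lazy_tree_reach _ _ _ [:: y]); first by rewrite /= xy.
by rewrite sub1seq.
Qed.

Variable R : realFieldType.
Hypothesis edges_gt0 : (0 < #|edges G|)%N.
Local Notation unreached N x y := (prob R (edges G) N (fun e => ~~ reach x y e)).

Lemma unreached_antitone N1 N2 x y : (N1 <= N2)%N ->
  unreached N2 x y <= unreached N1 x y.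
Proof.
move=> N12; rewrite -(subnKC N12) /prob expect_cat; apply: le_expect => // e1.
rewrite -[leRHS](expect_cst edges_gt0 (N2 - N1)); apply: le_expect => // e2.
rewrite ler_nat; have := @reach_cat x y y e1 e2.
case: (reach x y e1) => [/(_ isT (reach_refl _ _)) -> //|_].
by case: (reach _ _ _).
Qed.

(** The start [x] is in the tree from the beginning, so each block of [N] ticks
    offers an independent chance to reach [y] from [x]. *)
Lemma unreached_rounds k N x y : unreached (k * N) x y <= unreached N x y ^+ k.
Proof.
elim: k => [|k IH]; first by rewrite expr0 prob_le1.
rewrite mulSn exprS; apply: le_trans (_ : unreached N x y * unreached (k * N) x y <= _).
  rewrite /prob -expect_mul_cat //; apply: le_expect => // e.
  rewrite -natrM mulnb ler_nat -negb_or.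
  have h1 : reach x y (take N e) -> reach x y e.
    by rewrite -{2}[e](cat_take_drop N) => /reach_cat; apply; exact: reach_refl.
  have h2 : reach x y (drop N e) -> reach x y e.
    by rewrite -{2}[e](cat_take_drop N); apply: reach_cat; exact: reach_refl.
  case: (reach x y (take N e)) h1 => [->//|_].
  by case: (reach x y (drop N e)) h2 => [->//|_]; exact: leq_b1.
by rewrite ler_wpM2l ?prob_ge0.
Qed.

Lemma unreached_via N1 N2 x y z :
  unreached (N1 + N2) x z <= unreached N1 x y + unreached N2 y z.
Proof.
rewrite {1}/prob.
apply: le_trans (_ : expect (edges G) (N1 + N2)
  (fun e => (~~ reach x y (take N1 e))%:R * 1 + 1 * (~~ reach y z (drop N1 e))%:R) <= _).
  apply: le_expect => // e; rewrite mulr1 mul1r -natrD ler_nat.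
  have := @reach_cat x y z (take N1 e) (drop N1 e); rewrite cat_take_drop.
  case: (reach x y _) => /=; last by move=> _; case: (reach x z e).
  by case: (reach y z _) => [/(_ isT isT) ->//|_]; case: (reach x z e).
rewrite expectD (expect_mul_cat edges_gt0 N1 N2 (fun e => (~~ reach x y e)%:R) (fun=> 1)).
rewrite (expect_mul_cat edges_gt0 N1 N2 (fun=> 1) (fun e => (~~ reach y z e)%:R)).
by rewrite !expect_cst // mulr1 mul1r.
Qed.

End Reach.

(** * The cube *)

Section Cube.
Variable d : nat.
Implicit Types (x y z : cube d) (B C : {set 'I_d}).

Definition flip x B : cube d := [ffun i => x i (+) (i \in B)].
Definition diff x y : {set 'I_d} := [set i | x i != y i].

Lemma diff_flip x B : diff x (flip x B) = B.
Proof. by apply/setP => i; rewrite !inE ffunE; case: (x i); case: (i \in B). Qed.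

Lemma flip_diff x y : flip x (diff x y) = y.
Proof. by apply/ffunP => i; rewrite ffunE inE; case: (x i); case: (y i). Qed.

Lemma flip_inj x : injective (flip x).
Proof. by move=> B C h; rewrite -(diff_flip x B) h diff_flip. Qed.

Lemma flip_adj x B b : b \in B -> @adj (cube d) (flip x (B :\ b)) (flip x B).
Proof.
move=> bB; rewrite /= /cube_adj; apply/cards1P; exists b; apply/setP => i.
rewrite !inE !ffunE !inE; have [->|_] := eqVneq i b; last by rewrite eqxx.
by rewrite bB; case: (x b).
Qed.

Lemma flip_edge_inj x B C b c : b \in B -> c \in C -> #|B| = #|C| ->
  [set flip x (B :\ b); flip x B] = [set flip x (C :\ c); flip x C] ->
  B = C /\ b = c.
Proof.
move=> bB cC cBC /set2_eqP [[/flip_inj h1 /flip_inj h2]|[/flip_inj h1 _]].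
  split=> //; apply/eqP; have : b \notin C :\ c by rewrite -h1 !inE eqxx.
  by rewrite !inE -h2 bB andbT negbK.
by move: cBC; rewrite (cardsD1 b B) bB h1 => /eqP; rewrite eqn_leq ltnn.
Qed.

Lemma edge_in (G : sgraph) (x y : G) : adj x y -> [set x; y] \in edges G.
Proof. by move=> xy; apply/imsetP; exists (x, y); rewrite ?inE. Qed.

Lemma adj_diff x y : @adj (cube d) x y = (#|diff x y| == 1%N).
Proof. by []. Qed.

Lemma cube_degree x : (#|[set y | @adj (cube d) x y]| <= d)%N.
Proof.
rewrite -[X in (_ <= X)%N]card_ord -cardsT.
apply: leq_trans (leq_imset_card (fun i => flip x [set i]) _).
apply: subset_leq_card; apply/subsetP => y; rewrite inE adj_diff => /cards1P[i yi].
by apply/imsetP; exists i; rewrite // -yi flip_diff.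
Qed.

Lemma flip1_adj x i : @adj (cube d) x (flip x [set i]).
Proof. by rewrite adj_diff diff_flip cards1. Qed.

Lemma cube_edges_ge : (d <= #|edges (cube d)|)%N.
Proof.
pose x : cube d := [ffun=> false].
rewrite -[X in (X <= _)%N]card_ord -cardsT.
rewrite -(card_imset _ (_ : injective (fun i => [set x; flip x [set i]]))).
  apply: subset_leq_card; apply/subsetP => f /imsetP[i _ ->].
  by apply: edge_in; apply: flip1_adj.
move=> i j /set2_eqP[[_ /flip_inj/set1_inj ->//]|[h _]].
have := diff_flip x [set j]; rewrite -h => /setP /(_ j).
by rewrite !inE !eqxx.
Qed.

Lemma card_diff_path x (p : seq (cube d)) : path (@adj (cube d)) x p ->
  (#|diff x (last x p)| <= size p)%N.
Proof.
elim: p x => [|y p IH] x /=.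
  by move=> _; rewrite leqn0 cards_eq0; apply/eqP/setP => i; rewrite !inE eqxx.
move=> /andP[xy yp]; rewrite -add1n -(eqP xy).
apply: leq_trans (leq_add (leqnn _) (IH y yp)).
apply: leq_trans (leq_card_setU _ _); apply: subset_leq_card; apply/subsetP => i.
by rewrite !inE; case: (x i); case: (y i); case: (_ i).
Qed.

(** Half of the coordinates that must change and half of those that must not. *)
Lemma cube_midpoint x y : (4 <= d)%N -> exists z,
  [/\ (d <= 4 * #|diff x z|)%N, (d <= 4 * #|~: diff x z|)%N,
      (d <= 4 * #|diff z y|)%N & (d <= 4 * #|~: diff z y|)%N].
Proof.
move=> d4; set D := diff x y.
have half (E : {set 'I_d}) : exists2 F : {set 'I_d}, F \subset E & #|F| = #|E|./2.
  exists [set:: take #|E|./2 (enum E)].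
    by apply/subsetP => i; rewrite inE => /mem_take; rewrite mem_enum.
  rewrite cardsE (card_uniqP (take_uniq _ (enum_uniq _))) size_takel //.
  by rewrite -cardE; lia.
have [F1 s1 c1] := half D; have [F2 s2 c2] := half (~: D).
have cD : (#|D| + #|~: D| = d)%N by rewrite cardsC card_ord.
have disj (E1 E2 : {set 'I_d}) : E1 \subset D -> E2 \subset ~: D ->
    #|E1 :|: E2| = (#|E1| + #|E2|)%N.
  move=> h1 h2; apply/eqP; rewrite (leq_card_setU E1 E2).2.
  by apply: disjointWl h1 _; rewrite disjoint_sym disjoints_subset.
exists (flip x (F1 :|: F2)); rewrite diff_flip.
have -> : diff (flip x (F1 :|: F2)) y = (D :\: F1) :|: F2.
  apply/setP => i; have := subsetP s1 i; have := subsetP s2 i.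
  rewrite !inE ffunE !inE.
  case: (i \in F1); case: (i \in F2); case: (x i); case: (y i) => //= h1 h2;
    by rewrite ?h1 ?h2 //; have := h1 isT; have := h2 isT.
have cs1 : #|F1 :|: F2| = (#|D|./2 + #|~: D|./2)%N by rewrite disj // c1 c2.
have cs2 : #|(D :\: F1) :|: F2| = (#|D| - #|D|./2 + #|~: D|./2)%N.
  by rewrite disj ?subsetDl // cardsDS // c1 c2.
have comp (E : {set 'I_d}) : (#|E| + #|~: E| = d)%N by rewrite cardsC card_ord.
have := comp (F1 :|: F2); have := comp ((D :\: F1) :|: F2).
rewrite cs1 cs2; split; lia.
Qed.

End Cube.

(** * One round *)

Section Round.
Variables (R : realFieldType) (d : nat) (s v : cube d) (W : nat).
Hypothesis edges_gt0 : (0 < #|edges (cube d)|)%N.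

Local Notation M := #|edges (cube d)|.
Local Notation D := (diff s v).
Local Notation p := (hit R (edges (cube d)) W).
Hypothesis window_hit : 24 <= #|D|%:R * p.

Let p_gt0 : 0 < p.
Proof.
rewrite lt0r hit_ge0 // andbT; apply: contraTneq window_hit => ->.
by rewrite mulr0 -ltNge.
Qed.

Definition cube_edge (x : cube d) (B : {set 'I_d}) (b : 'I_d) : {set cube d} :=
  [set flip x (B :\ b); flip x B].

Lemma cube_edge_in x (B : {set 'I_d}) b : b \in B ->
  cube_edge x B b \in edges (cube d).
Proof. by move=> bB; apply: edge_in; exact: flip_adj. Qed.

(** The windows follow one another, so a crossing draws its edges in the order in
    which it uses them. *)
Lemma crossings_reach (x : cube d) n e (B : {set 'I_d}) : #|B| = n ->
  crossings R (cube_edge x) W n e B != 0 -> reach x (flip x B) e.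
Proof.
elim: n e B => [|n IH] e B cB.
  move/eqP: cB; rewrite cards_eq0 => /eqP -> _.
  rewrite (_ : flip x set0 = x) ?reach_refl //.
  by apply/ffunP => i; rewrite ffunE inE addbF.
rewrite /= psumr_neq0; last by move=> b _; rewrite mulr_ge0 ?crossings_ge0 ?ler0n.
case/hasP => b _ /andP[bB h].
have [c0 eb] : crossings R (cube_edge x) W n (take (n * W) e) (B :\ b) != 0 /\
    cube_edge x B b \in drop (n * W) e.
  move: h; rewrite lt0r mulf_eq0 negb_or pnatr_eq0 eqb0 negbK.
  by case/andP => /andP[].
rewrite -(cat_take_drop (n * W) e); apply: reach_cat (IH _ _ _ c0) _.
  by move: cB; rewrite (cardsD1 b) bB => -[].
by apply: reach_edge eb; apply: flip_adj.
Qed.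

Lemma crossings_mono (x : cube d) n e1 e2 (B : {set 'I_d}) (E : {set {set cube d}}) :
  (forall (C : {set 'I_d}) b, C \subset B -> b \in C -> cube_edge x C b \in E) ->
  fewer_in E e1 e2 ->
  crossings R (cube_edge x) W n e2 B <= crossings R (cube_edge x) W n e1 B.
Proof.
elim: n e1 e2 B => //= n IH e1 e2 B BE h; apply: ler_sum => b bB.
apply: ler_pM; rewrite ?crossings_ge0 ?ler0n //.
  apply: IH; last exact: fewer_in_take.
  by move=> C c CB cC; apply: BE => //; exact: subset_trans CB (subsetDl _ _).
rewrite ler_nat; have := fewer_in_mem (fewer_in_drop (n * W) h) (BE B b (subxx _) bB).
by case: (_ \in drop _ e2) => [->|].
Qed.

(** The attempts of a round, one for each coordinate [i] that need not change:
    flip [i] first, change the coordinates of [D] along a crossing, and flip [i]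
    back at the end. *)
Definition attempt (i : 'I_d) (e : seq {set cube d}) : bool :=
  [&& [set s; flip s [set i]] \in take M e,
      crossings R (cube_edge (flip s [set i])) W #|D| (take (#|D| * W) (drop M e)) D != 0 &
      [set flip (flip s [set i]) D; v] \in drop (#|D| * W) (drop M e)].

Definition round_length := (M + (#|D| * W + M))%N.

Lemma flip_flip (x : cube d) (B C : {set 'I_d}) : flip (flip x B) C = flip (flip x C) B.
Proof. by apply/ffunP => i; rewrite !ffunE addbAC. Qed.

Lemma last_edge_adj i : @adj (cube d) (flip (flip s [set i]) D) v.
Proof.
rewrite flip_flip flip_diff adj_sym; exact: flip1_adj.
Qed.

Lemma attempt_reach i e : attempt i e -> reach s v e.
Proof.
case/and3P => h1 h2 h3; rewrite -(cat_take_drop M e).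
apply: reach_cat (reach_edge (flip1_adj s i) h1) _.
rewrite -(cat_take_drop (#|D| * W) (drop M e)).
apply: reach_cat (crossings_reach (erefl _) h2) _.
by apply: reach_edge h3; exact: last_edge_adj.
Qed.

Lemma hit_edges_ge_half : 2^-1 <= hit R (edges (cube d)) M.
Proof.
apply: le_trans (hit_ge R edges_gt0 M).
by rewrite ler_pdivlMr ?addr_gt0 ?ltr0n //; lra.
Qed.

Lemma prob_attempt i : 8^-1 <= prob R (edges (cube d)) round_length (attempt i).
Proof.
rewrite /round_length /prob.
pose a1 (e : seq {set cube d}) : R := ([set s; flip s [set i]] \in e)%:R.
pose a2 (e : seq {set cube d}) : R := (crossings R (cube_edge (flip s [set i])) W #|D| e D != 0)%:R.
pose a3 (e : seq {set cube d}) : R := ([set flip (flip s [set i]) D; v] \in e)%:R.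
pose a23 (e : seq {set cube d}) := a2 (take (#|D| * W) e) * a3 (drop (#|D| * W) e).
rewrite (@eq_expect _ _ _ edges_gt0 _ _ (fun e => a1 (take M e) * a23 (drop M e)));
  last by move=> e; rewrite /attempt /a1 /a23 /a2 /a3 -!natrM !mulnb.
rewrite (expect_mul_cat edges_gt0 _ _ a1 a23) (expect_mul_cat edges_gt0 _ _ a2 a3).
have := hit_prob R edges_gt0 M (edge_in (flip1_adj s i)); rewrite /prob => ->.
have := hit_prob R edges_gt0 M (edge_in (last_edge_adj i)); rewrite /prob => ->.
have cr := @prob_crossing R _ _ edges_gt0 _ (cube_edge (flip s [set i])) W
  (@cube_edge_in _) (@flip_edge_inj _ _) p_gt0 D window_hit.
rewrite (_ : 8^-1 = 2^-1 * (2^-1 * 2^-1)); last by field.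
by rewrite !ler_pM ?mulr_ge0 ?invr_ge0 // hit_edges_ge_half.
Qed.

(** The subcubes in which the different attempts perform their crossings. *)
Definition slab (i : 'I_d) : pred (cube d) :=
  fun x => [forall j in ~: D, (x j != s j) == (j == i)].

(** All edges that the attempt [i] looks at. Its first and last edges leave the
    subcube, but only towards [s] and [v], which belong to none of the
    subcubes. *)
Definition territory (i : 'I_d) : {set {set cube d}} :=
  [set f : {set cube d} | [exists x in f, slab i x] &&
    [forall x in f, [|| slab i x, x == s | x == v]]].

Lemma slab_flip i (B : {set 'I_d}) : i \notin D -> B \subset D ->
  slab i (flip (flip s [set i]) B).
Proof.
move=> iD BD; apply/forall_inP => j; rewrite in_setC => jD; rewrite !ffunE inE.
rewrite (contraNF (subsetP BD j) jD) addbF.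
by case: (s j); case: (j == i).
Qed.

Lemma territory_disjoint i j : i \notin D -> j \notin D -> i != j ->
  [disjoint territory i & territory j].
Proof.
move=> iD jD ij; rewrite disjoints_subset; apply/subsetP => f.
rewrite !inE => /andP[/exists_inP[x xf xi] _]; apply/negP => /andP[_ /forall_inP/(_ x xf)].
have : x i != s i by move/forall_inP: xi => /(_ i); rewrite inE iD eqxx => /(_ isT) /eqP.
move=> xsi; case/or3P => [/forall_inP /(_ i)|/eqP xs|/eqP xv].
- by rewrite inE iD xsi (negPf ij) => /(_ isT).
- by rewrite xs eqxx in xsi.
- by move: iD; rewrite inE negbK eq_sym -xv (negPf xsi).
Qed.

Lemma territoryP i x y : slab i x || slab i y ->
  [|| slab i x, x == s | x == v] -> [|| slab i y, y == s | y == v] ->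
  [set x; y] \in territory i.
Proof.
move=> xy hx hy; rewrite inE; apply/andP; split.
  by case/orP: xy => h; apply/exists_inP; [exists x|exists y]; rewrite // !inE eqxx ?orbT.
by apply/forall_inP => z; rewrite !inE => /orP[]/eqP->.
Qed.

Lemma attempt_decreasing i : i \notin D ->
  decreasing_in (territory i) (fun e => (~~ attempt i e)%:R : R).
Proof.
move=> iD e1 e2 h; rewrite ler_nat.
suff : attempt i e2 -> attempt i e1 by case: (attempt i e2) => [->//|_]; exact: leq_b1.
have sl B := @slab_flip i B iD.
have slab0 : slab i (flip s [set i]).
  have := sl set0 (sub0set _); rewrite (_ : flip _ set0 = flip s [set i]) //.
  by apply/ffunP => j; rewrite [LHS]ffunE inE addbF.
case/and3P => h1 h2 h3; apply/and3P; split.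
- apply: fewer_in_mem (fewer_in_take M h) _ h1.
  by apply: territoryP; rewrite ?slab0 ?eqxx ?orbT.
- have h' := fewer_in_take (#|D| * W) (fewer_in_drop M h).
  apply: contraNneq h2 => z0; rewrite eq_le crossings_ge0 andbT -z0.
  apply: crossings_mono h' => C b CD bC.
  by apply: territoryP; rewrite !sl ?orbT // (subset_trans (subsetDl _ _)).
- apply: fewer_in_mem (fewer_in_drop (#|D| * W) (fewer_in_drop M h)) _ h3.
  by apply: territoryP; rewrite ?sl ?subxx ?eqxx ?orbT.
Qed.

(** Distinct attempts use disjoint sets of edges, so their failures are negatively
    associated and the failure probabilities multiply. *)
Lemma unreached_round :
  prob R (edges (cube d)) round_length (fun e => ~~ reach s v e) <=
    (7 / 8) ^+ #|~: D|.
Proof.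
apply: le_trans (_ : expect (edges (cube d)) round_length
  (fun e => \prod_(i <- enum (~: D)) (~~ attempt i e)%:R) <= _).
  apply: le_expect => // e; have [_|/negP h] := boolP (reach s v e).
    by apply: prodr_ge0 => i _; rewrite ler0n.
  rewrite big1 // => i _; case: (boolP (attempt i e)) => // /attempt_reach.
  by move/h.
apply: le_trans (expect_prod_le edges_gt0 _ (Bs := territory) (enum_uniq _) _ _ _) _.
- by move=> i e; rewrite ler0n.
- by move=> i; rewrite mem_enum inE => iD; exact: attempt_decreasing.
- by move=> i j; rewrite !mem_enum ![_ \in ~: _]inE; exact: territory_disjoint.
rewrite big_enum /= -prodr_const; apply: ler_prod => i _.
rewrite expect_ge0 //=.
have := probC R edges_gt0 round_length (attempt i); rewrite /prob => ->.
have := prob_attempt i; rewrite /prob => h.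
by rewrite lerBlDr -lerBlDl (le_trans _ h) //; lra.
Qed.

End Round.

(** * Covering time and height *)

Section Cover.
Variables (R : realFieldType) (d : nat).

Local Notation M := #|edges (cube d)|.
Local Notation unreached N x y :=
  (prob R (edges (cube d)) N (fun e => ~~ reach x y e)).

Section LargeDimension.
Hypothesis d_ge : (400 <= d)%N.

Let M_ge : (d <= M)%N := cube_edges_ge d.
Let M_gt0 : (0 < M)%N.
Proof. by apply: leq_trans M_ge; apply: leq_trans d_ge. Qed.

(** About [192 * M / d] ticks, so that the step of a crossing, a given edge, is drawn
    in its window with probability at least [96 / d]. Then [#|E| >= d / 4] gives
    the mean 24 that [prob_crossing] requires, and [d] windows last for at most
    [193 * M] ticks. *)
Definition window := ((192 * M) %/ d).+1.

Let window_ge : (192 * M <= d * window)%N.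
Proof.
by rewrite /window [X in (_ <= X)%N]mulnC ltnW // ltn_ceil // (leq_trans _ d_ge).
Qed.

Let window_le : (d * window <= 193 * M)%N.
Proof. have := leq_trunc_div (192 * M) d; rewrite /window [(d * _)%N]mulnC mulSn; lia. Qed.

Let window_le_edges : (window <= M)%N.
Proof. have := window_le; nia. Qed.

Lemma window_hit (E : {set 'I_d}) : (d <= 4 * #|E|)%N ->
  24 <= #|E|%:R * hit R (edges (cube d)) window.
Proof.
move=> dE; have h := hit_ge R M_gt0 window.
have M0 : 0 < M%:R :> R by rewrite ltr0n.
have w1 : 192 * M%:R <= d%:R * window%:R :> R by rewrite -!natrM ler_nat window_ge.
have w2 : window%:R <= M%:R :> R by rewrite ler_nat window_le_edges.
have d4 : d%:R <= 4 * #|E|%:R :> R by rewrite -natrM ler_nat.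
have h2 : 96 <= d%:R * hit R (edges (cube d)) window.
  apply: le_trans (ler_wpM2l (ler0n _ _) h).
  rewrite mulrA ler_pdivlMr; last by rewrite ltr_wpDr ?ler0n.
  by apply: le_trans _ w1; lra.
have := ler_wpM2r (hit_ge0 R M_gt0 window) d4; lra.
Qed.

(** A round takes at most [195 * M] ticks, and 48 rounds bring the failure
    probability from [(7 / 8) ^ (d / 4)] below [4 ^- d], as [(7 / 8) ^ 12 < 1 / 4]. *)
Lemma unreached_leg x y :
  (d <= 4 * #|diff x y|)%N -> (d <= 4 * #|~: diff x y|)%N ->
  unreached (48 * 195 * M) x y <= 4^-1 ^+ d.
Proof.
move=> h1 h2.
have len : (48 * round_length x y window <= 48 * 195 * M)%N.
  rewrite -mulnA leq_mul2l /= /round_length.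
  have : (#|diff x y| * window <= d * window)%N.
    by rewrite leq_mul2r -[X in (_ <= X)%N](card_ord d) max_card orbT.
  move=> /leq_trans/(_ window_le) h.
  apply: leq_trans (_ : M + (193 * M + M) <= _)%N.
    by rewrite leq_add2l leq_add2r.
  by rewrite addnC -addnA addnn -mul2n -mulnDl.
apply: le_trans (unreached_antitone R M_gt0 x y len) _.
apply: le_trans (unreached_rounds R M_gt0 48 _ x y) _.
apply: le_trans (_ : ((7 / 8) ^+ #|~: diff x y|) ^+ 48 <= _).
  rewrite lerXn2r ?nnegrE ?prob_ge0 ?exprn_ge0 //; first by lra.
  by apply: unreached_round => //; exact: window_hit.
rewrite -exprM mulnC -[48%N]/(12 * 4)%N -mulnA exprM.
apply: le_trans (_ : 4^-1 ^+ (4 * #|~: diff x y|) <= _).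
  rewrite lerXn2r ?nnegrE ?exprn_ge0 //; try lra.
by apply: ler_wiXn2l => //; lra.
Qed.

Lemma unreached_cube s v : unreached (2 * (48 * 195) * M) s v <= 2 * 4^-1 ^+ d.
Proof.
have [z [h1 h2 h3 h4]] := cube_midpoint s v (leq_trans (isT : (4 <= 400)%N) d_ge).
rewrite -mulnA mul2n -addnn; apply: le_trans (unreached_via R M_gt0 _ _ _ z _) _.
by rewrite mulr2n mulrDl mul1r lerD // unreached_leg.
Qed.

(** The bound [4 ^- d] for a single vertex leaves room for the union over the
    [2 ^ d] vertices. *)
Lemma prob_not_covered s :
  prob R (edges (cube d)) (2 * (48 * 195) * M)
    (fun e => [exists v : cube d, ~~ reach s v e]) <= 2 * 2^-1 ^+ d.
Proof.
apply: le_trans (prob_union R M_gt0 xpredT _ (fun v e => ~~ reach s v e)) _.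
apply: le_trans (ler_sum _ (fun v _ => unreached_cube s v)) _.
rewrite big_const iter_addr_0 card_ffun card_bool card_ord -[_ *+ _]mulr_natr.
rewrite natrX -mulrA -exprMn (_ : 4^-1 * 2%:R = 2^-1) //.
by field.
Qed.

End LargeDimension.

(** The expected number of time-increasing paths with [k] edges is at most
    [(t * d) ^ k / k!], which is at most [(4 * t * d / k) ^ k]. *)
Lemma prob_long_path t s : (0 < d)%N -> (0 < t)%N ->
  prob R (edges (cube d)) (t * M) (has_path (8 * t * d) s) <= 2^-1 ^+ (8 * t * d).
Proof.
move=> d0 t0; have M_gt0 : (0 < M)%N by apply: leq_trans (cube_edges_ge d).
set k := (8 * t * d)%N; set N := (t * M)%N.
apply: le_trans (prob_has_path R M_gt0 (@cube_degree d) N k s) _.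
have k0 : (0 < k)%N by rewrite !muln_gt0 d0 t0.
have binle : ('C(N, k) * k ^ k <= 4 ^ k * N ^ k)%N.
  apply: leq_trans (leq_mul (leqnn _) (exp_le_ffact (leqnn k))) _.
  rewrite ffactnn mulnCA leq_mul2l bin_ffact; apply/orP; right.
  rewrite ffact_prod -[X in (_ <= _ ^ X)%N](card_ord k) -prod_nat_const.
  by apply: leq_prod => i _; exact: leq_subr.
have kk : 0 < (k ^ k)%:R :> R by rewrite ltr0n expn_gt0 k0.
rewrite -(ler_pM2l kk) mulrA -natrM mulnC.
apply: le_trans (ler_wpM2r _ (_ : _ <= (4 ^ k * N ^ k)%:R)) _.
- by rewrite exprn_ge0 // divr_ge0.
- by rewrite ler_nat.
rewrite -expnMn !natrX -!exprMn le_eqVlt; apply/orP; left; apply/eqP; congr (_ ^+ _).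
rewrite /k /N !natrM; field.
by rewrite pnatr_eq0 -lt0n.
Qed.

End Cover.

(** * The height of the spanning tree *)

Section TypicalHeight.
Variables (R : realType) (d : nat).
Hypothesis d_ge : (400 <= d)%N.

Local Notation M := #|edges (cube d)|.

(** The antipode of the root is at distance [d]. *)
Lemma cube_height_ge (s : cube d) e : (lazy_tree s e).1 = setT ->
  (d <= height s (lazy_tree s e))%N.
Proof.
move=> full; apply: (@height_ge _ _ _ _ (flip s setT)); first by rewrite full inE.
move=> p pp lp; have := card_diff_path pp.
by rewrite lp diff_flip cardsT card_ord.
Qed.

Lemma cube_height_typical (s : cube d) :
  1 - 3 * 2^-1 ^+ d <=
  spanning_tree_prob R s (fun T => (1 * d%:R <= (height s T)%:R :> R) &&
    ((height s T)%:R <= (8 * (2 * (48 * 195)))%N%:R * d%:R :> R)).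
Proof.
set t := (2 * (48 * 195))%N.
have M_gt0 : (0 < M)%N.
  by apply: leq_trans (cube_edges_ge d); apply: leq_trans d_ge.
have t_gt0 : (0 < t)%N by [].
have h1 := prob_not_covered R d_ge s; rewrite -/t in h1.
clearbody t.
have d_gt0 : (0 < d)%N by apply: leq_trans d_ge.
set N := (t * M)%N; set k := (8 * t * d)%N.
apply: le_trans (spanning_tree_prob_ge R s M_gt0 N _).
set A := (X in prob _ _ _ X).
have -> : prob R (edges (cube d)) N A = 1 - prob R (edges (cube d)) N (fun e => ~~ A e).
  by rewrite probC // subKr.
rewrite lerD2l lerN2.
apply: le_trans (_ : prob R (edges (cube d)) N
    (fun e => [exists v : cube d, ~~ reach s v e] || has_path k s e) <= _).
  apply: le_prob_in => // e _ _; have [//|cov] := boolP [exists v : cube d, ~~ reach s v e].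
  have full : (lazy_tree s e).1 = setT.
    apply/setP => v; rewrite inE; move: cov; rewrite negb_exists => /forallP /(_ v).
    by rewrite negbK.
  rewrite /A full eqxx /= mul1r ler_nat cube_height_ge //= -natrM ler_nat -ltnNge.
  by move=> /ltnW /has_path_height.
apply: le_trans (probU R M_gt0 N _ _) _.
have h2 := @prob_long_path R d t s d_gt0 t_gt0.
have : 2^-1 ^+ k <= 2^-1 ^+ d :> R.
  by apply: ler_wiXn2l; [lra | lra | rewrite leq_pmull // muln_gt0 t_gt0].
by move: h1 h2; rewrite -/N -/k; lra.
Qed.

End TypicalHeight.

(** The error is [2 ^ 401 / (n + 1)]: it exceeds one below dimension 400, where nothing
    is claimed, and dominates [3 / n] for [n = 2 ^ d]. *)
Lemma error_bound_large (R : realFieldType) d :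
  3 * 2^-1 ^+ d <= 2 ^+ 401 * (2 ^ d)%N.+1%:R^-1 :> R.
Proof.
rewrite ler_pdivlMr ?ltr0n // -[(2 ^ d)%N.+1%:R]natr1 natrX mulrDr mulr1 -mulrA -exprMn.
rewrite mulVf ?pnatr_eq0 // expr1n.
have h1 : 2^-1 ^+ d <= 1 :> R by apply: exprn_ile1; lra.
have h2 : 2 ^+ 3 <= 2 ^+ 401 :> R by rewrite ler_eXn2l // ltr1n.
have h3 : 2 ^+ 3 = 8 :> R by rewrite !exprS expr0; lra.
lra.
Qed.

Lemma error_bound_small (R : realFieldType) d : (d < 400)%N ->
  1 <= 2 ^+ 401 * (2 ^ d)%N.+1%:R^-1 :> R.
Proof.
move=> d_lt; rewrite ler_pdivlMr ?ltr0n // mul1r -natrX ler_nat.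
apply: leq_trans (_ : 2 ^ d.+1 <= _)%N; last by rewrite leq_exp2l // ltnW.
by rewrite expnS mul2n -addnn -addn1 leq_add2l expn_gt0.
Qed.

From mathcomp Require Import all_classical all_reals all_analysis.
Import numFieldNormedType.Exports.

Local Open Scope classical_set_scope.
Local Open Scope ring_scope.

Theorem theorem5 (R : realType) :
  exists c1 c2 : R, 0 < c1 /\ c1 <= c2 /\
  exists eps : nat -> R, (eps n @[n --> \oo] --> (0 : R)) /\
  forall (d : nat) (s : cube d),
    1 - eps (2 ^ d)%N <=
      spanning_tree_prob R s
        (fun T => (c1 * d%:R <= (height s T)%:R) &&
                  ((height s T)%:R <= c2 * d%:R)).
Proof.
exists 1, (8 * (2 * (48 * 195)))%N%:R; split; first exact: ltr01.
split; first by rewrite ler1n.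
exists (fun n => 2 ^+ 401 * harmonic n); split.
  rewrite -[X in _ --> X](mulr0 (2 ^+ 401)).
  by apply: cvgM; [exact: cvg_cst | exact: cvg_harmonic].
move=> d s; have [d_ge|d_lt] := leqP 400 d.
  apply: le_trans (cube_height_typical R d_ge s); rewrite lerD2l lerN2.
  exact: error_bound_large.
apply: le_trans (_ : 0 <= _); first by rewrite subr_le0 error_bound_small.
by apply: sumr_ge0 => T _; exact: growth_law_ge0.
Qed.
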